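(* Let $p$ be an odd prime and $d\ge 1$ an integer. If $p\leq 2d+1$ and $(p-1)^2/2$ is not of the form $jd+1$ for any $j=1,2,\ldots,p-1$, then the pair $(d,p)$ is admissible.
   Context: Let $p$ be an odd prime and $d\geq 1$. The pair $(d,p)$ is called admissible if, given any continuous injective map $f:S^{d}\to \mathbb{R}^{d+1}$ and any $(p-1)/2$ metrics $\rho_1,\ldots,\rho_{(p-1)/2}$ on $\mathbb{R}^{d+1}$, each equivalent to the Euclidean metric of $\mathbb{R}^{d+1}$ (i.e. inducing the same topology), there are $p$ different points $f(x_0),\ldots,f(x_{p-1})$ in the image of $f$ such that $$\rho_j(f(x_0), f(x_{j})) =\rho_j(f(x_{j}), f(x_{2j}))=\cdots=\rho_j(f(x_{(p-1)j}), f(x_0))$$ for all $j=1,2,\ldots,(p-1)/2$, where the subscripts of the $x_i$ are taken modulo $p$. *)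

(* Defs.v *)
From HB Require Import structures.
From mathcomp Require Import all_boot all_order all_algebra.
From mathcomp Require Import all_classical all_reals all_analysis.
Set Implicit Arguments.
Unset Strict Implicit.
Unset Printing Implicit Defensive.
Import Order.TTheory GRing.Theory Num.Theory.
Import numFieldNormedType.Exports.
Local Open Scope classical_set_scope.
Local Open Scope ring_scope.

Definition is_metric (R : realType) (T : Type) (rho : T -> T -> R) : Prop :=
  [/\ forall x y, 0 <= rho x y,
      forall x y, rho x y = 0 <-> x = y,
      forall x y, rho x y = rho y x &
      forall x y z, rho x z <= rho x y + rho y z].

Definition metric_open (R : realType) (T : Type) (rho : T -> T -> R)
    (U : set T) : Prop :=
  forall x, U x -> exists2 e : R, 0 < e & [set y | rho x y < e] `<=` U.

Definition equivalent_metrics (R : realType) (T : Type)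
    (rho1 rho2 : T -> T -> R) : Prop :=
  forall U : set T, metric_open rho1 U <-> metric_open rho2 U.

(* The norm that the library puts on 'rV[R]_n is the sup norm, hence this
   explicit definition. *)
Definition euclidean_dist (R : realType) (n : nat) (x y : 'rV[R]_n) : R :=
  Num.sqrt (\sum_(i < n) (x ord0 i - y ord0 i) ^+ 2).

(* S^d, as a subset of R^(d+1). *)
Definition sphere (R : realType) (d : nat) : set 'rV[R]_d.+1 :=
  [set x | euclidean_dist 0 x = 1].
Arguments sphere : clear implicits.

(* A map S^d -> R^(d+1) is a function on R^(d+1) of which only the restriction
   to the sphere matters.  Only rho 1, ..., rho (p-1)/2 are constrained and used.
   Subscripts modulo p are elements of 'Z_p, which is the ring Z/p as soon as
   1 < p; for i = 0, ..., p-1 the i-th term of the chain of equalities is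
   rho_j(f(x_(ij)), f(x_((i+1)j))). *)
Definition admissible (R : realType) (d p : nat) : Prop :=
  forall (f : 'rV[R]_d.+1 -> 'rV[R]_d.+1)
         (rho : nat -> 'rV[R]_d.+1 -> 'rV[R]_d.+1 -> R),
    {within sphere R d, continuous f} ->
    (forall u v, sphere R d u -> sphere R d v -> f u = f v -> u = v) ->
    (forall j : nat, (1 <= j <= p.-1 %/ 2)%N ->
      is_metric (rho j) /\
      equivalent_metrics (rho j) (@euclidean_dist R d.+1)) ->
    exists x : 'Z_p -> 'rV[R]_d.+1,
      [/\ forall i, sphere R d (x i),
          injective (fun i => f (x i)) &
          forall j : nat, (1 <= j <= p.-1 %/ 2)%N ->
          forall i : 'Z_p,
            rho j (f (x (i * j%:R))) (f (x ((i + 1) * j%:R))) =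
            rho j (f (x 0)) (f (x j%:R))].

(* The topology used for the continuity of f is the Euclidean one. *)
Lemma euclidean_openE (R : realType) (n : nat) (U : set 'rV[R]_n.+1) :
  open U <-> metric_open (@euclidean_dist R n.+1) U.
Proof.
have ballE (x y : 'rV[R]_n.+1) (e : R) : 0 < e ->
    ball x e y <-> forall i, `|x ord0 i - y ord0 i| < e.
  move=> e0; split => [[_ h] i|h]; first exact: h.
  by split => // i j; rewrite (ord1 i); exact: h.
rewrite openE; split => [oU x /oU/nbhs_ballP[e /= e0 eU]|mU x /mU[e e0 eU]].
  exists e => // y /= xye; apply: eU; apply/ballE => // i.
  apply: le_lt_trans xye; rewrite -sqrtr_sqr ler_wsqrtr//.
  rewrite (bigD1 i)//= lerDl.
  by apply: sumr_ge0 => k _; exact: sqr_ge0.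
have d0 : 0 < e / n.+1%:R by rewrite divr_gt0.
apply/nbhs_ballP; exists (e / n.+1%:R) => //= y /(ballE _ _ _ d0) xy.
apply: eU => /=; rewrite /euclidean_dist -(gtr0_norm e0) -sqrtr_sqr.
rewrite ltr_sqrt ?exprn_gt0//.
have lt1 i : (x ord0 i - y ord0 i) ^+ 2 < (e / n.+1%:R) ^+ 2.
  by rewrite -real_normK ?num_real// ltrXn2r// ltW.
apply: (@lt_le_trans _ _ (\sum_(i < n.+1) (e / n.+1%:R) ^+ 2)).
  by apply: ltr_sum => //; apply/hasP; exists ord0; rewrite ?mem_index_enum.
rewrite sumr_const card_ord -(mulr_natr (_ ^+ 2)) exprMn -(mulrA (e ^+ 2)).
rewrite ler_piMr ?sqr_ge0// [_^-1 ^+ 2]expr2 -mulrA mulVf ?pnatr_eq0// mulr1.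
by rewrite invf_le1 ?ltr0n// ler1n.
Qed.

(* Main.v *)
Require Import Defs.
From HB Require Import structures.
From mathcomp Require Import all_boot all_order all_fingroup all_algebra.
From mathcomp Require Import zify ring lra.

(** Write m = (p - 1) / 2, so that m <= d, and read indices modulo p.  It is
    enough to find points x_0, ..., x_(p-1) of the sphere, not all equal, such
    that rho_j(f x_i, f x_(i+j)) is independent of i for every j <= m.  If two of
    them coincided, one of these common values would be 0, hence x_i = x_(i+j)
    for some j prime to p and for all i, and all the points would coincide.

    Such a tuple is a zero, off the diagonal, of a map from (S^d)^p to W^m that
    commutes with the cyclic shift, where W is the regular representation of Z/p
    modulo constants.  Repeat some of the metrics so that m = d.  The Euler class
    e of W^d lives in degree N = d (p - 1), and if there were no zero off the
    diagonal then e would vanish there.  Two evaluations of e, with coefficients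
    in F_p, then contradict each other.

    - On the cycle {x_0 = const} of (S^d)^p it vanishes, because without the group
      action e is a coboundary.
    - This cycle meets the diagonal once.  Modulo chains that avoid the diagonal it
      is homologous to the d-fold product of the cone y_i >= 0, min_i y_i = 0 of
      R^p.  The cone is invariant: away from its apex it is a sum of p translates,
      which contribute 0 modulo p, and the apex contributes a unit.

    This is made combinatorial.  The sphere is replaced by the grid torus
    (Z/8k)^d, which is mapped onto S^d by collapsing the complement of a cube
    ([chart]); a vertex of the p-th power of the torus is labelled, for each
    metric, with an index i at which rho_j(f x_i, f x_(i+j)) is largest, and the
    labels can be chosen to commute with the shift ([equivariant_choice]).  The
    class e is the cup product of the cocycles that detect all p labels on a
    simplex ([degree_form], [cup_form]).  Homologies are handled by one summation
    by parts ([stokes]).  It gives the vanishing on the slice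
    ([slice_product_eq0]) and the replacement of the slice by the cone, one
    coordinate of R^d at a time ([mixed_step]); the contribution away from the
    apex is [off_center_eq0].  At the apex the labels may be prescribed, and they
    are prescribed so that exactly one simplex contributes ([center_neq0]).

    The outcome is [discrete_theorem]: on every grid there is a small cube, far
    from the diagonal, on which each labelling takes all p values.  There all the
    distances rho_j(f x_i, f x_(i+j)) with the same j are nearly equal, and a
    cluster point for k going to infinity is the required tuple
    ([limit_configuration]). *)

Set Implicit Arguments.
Unset Strict Implicit.
Unset Printing Implicit Defensive.
Import GRing.Theory.
Local Open Scope ring_scope.

(** * Orientations, and cochains on sequences of vertices *)

Definition swap (a b x : nat) : nat :=
  if x == a then b else if x == b then a else x.

Lemma swapC a b x : swap a b x = swap b a x.
Proof. by rewrite /swap; case: eqP => [->|]; case: eqP => [->|]. Qed.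

Lemma swapK a b : involutive (swap a b).
Proof.
move=> x; rewrite /swap; case: (eqVneq x a) => [->|xa].
  by case: eqVneq => [->|]; rewrite ?eqxx.
case: (eqVneq x b) => [->|xb]; first by rewrite eqxx.
by rewrite (negbTE xa) (negbTE xb).
Qed.

Section Orientation.
Variables (F : fieldType) (I : eqType) (n : nat) (en : 'I_n -> I) (rk : I -> 'I_n).
Hypotheses (enK : cancel en rk) (rkK : cancel rk en).

Definition indicator_mx m (f : nat -> I) : 'M[F]_(m, n) :=
  \matrix_(i < m, c < n) (f i == en c)%:R.

Definition orient (f : nat -> I) : F := \det (indicator_mx n f).

Lemma orient_ext f g : (forall i, (i < n)%N -> f i = g i) -> orient f = orient g.
Proof.
by move=> fg; congr (\det _); apply/matrixP => i c; rewrite !mxE fg.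
Qed.

Lemma orient_swap f a b : (a < n)%N -> (b < n)%N -> a != b ->
  orient (f \o swap a b) = - orient f.
Proof.
move=> an bn ab; pose s := tperm (Ordinal an) (Ordinal bn).
have -> : orient (f \o swap a b) = \det (row_perm s (indicator_mx n f)).
  congr (\det _); apply/matrixP => i c; rewrite !mxE /=; congr (f _ == _)%:R.
  rewrite /s /swap; case: tpermP => [->|->|] /=; rewrite ?eqxx //.
    by case: eqP.
  by move=> /eqP/negbTE ia /eqP/negbTE ib; rewrite -!val_eqE /= in ia ib; rewrite ia ib.
by rewrite row_permE det_mulmx det_perm odd_tperm -val_eqE /= ab expr1 mulN1r.
Qed.

Lemma orient_inj f : orient f != 0 -> {in gtn n &, injective f}.
Proof.
move=> o0 a b an bn fab; apply/eqP; apply: contraNT o0 => ab; apply/eqP.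
apply: (@determinant_alternate _ _ _ (Ordinal an) (Ordinal bn)) => //.
by move=> c; rewrite !mxE /= fab.
Qed.

Lemma orient_neq0 f : {in gtn n &, injective f} -> orient f != 0.
Proof using enK rkK.
move=> fi.
have inj : injective (fun i : 'I_n => rk (f i)).
  move=> i j /(can_inj rkK) ij; apply/val_inj; apply: fi => //; exact: ltn_ord.
have -> : orient f = \det (perm_mx (perm inj) : 'M[F]__).
  congr (\det _); apply/matrixP => i c; rewrite !mxE permE.
  by rewrite -{2}[c]enK (inj_eq (can_inj rkK)).
by rewrite det_perm signr_eq0.
Qed.

(** A permutation g of the values multiplies every orientation by the same sign.
    If g has odd order, this sign has an odd power equal to 1, so it is 1.  It is
    applied to cyclic shifts, which is where p odd is used. *)
Lemma orient_comp (g : I -> I) q : injective g -> odd q ->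
  (forall x, iter q g x = x) -> forall f, orient (g \o f) = orient f.
Proof using enK rkK.
move=> gi oq gq.
pose h c := rk (g (en c)).
have hi : injective h by move=> c c' /(can_inj rkK) /gi /(can_inj enK).
pose s := perm hi.
have gE f : orient f = orient (g \o f) * (-1) ^+ s.
  have -> : orient f = \det (col_perm s (indicator_mx n (g \o f))).
    congr (\det _); apply/matrixP => i c.
    by rewrite !mxE permE /= /h rkK (inj_eq gi).
  by rewrite col_permE det_mulmx det_perm odd_permV.
have gE' r f : orient f = orient (iter r g \o f) * ((-1) ^+ s) ^+ r.
  elim: r => [|r IH]; first by rewrite expr0 mulr1; apply: orient_ext.
  by rewrite IH gE exprS mulrA; congr (_ * _ * _).
move=> f; rewrite [RHS]gE; suff -> : (-1) ^+ s = 1 :> F by rewrite mulr1.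
have [n0|n0] := posnP n.
  have -> : s = 1%g by apply/permP => c; have := ltn_ord c; rewrite {2}n0.
  by rewrite odd_perm1.
pose f0 i := if insub i is Some c then en c else en (Ordinal n0).
have f00 : orient f0 != 0.
  apply: orient_neq0 => a b; rewrite !inE => an bn; rewrite /f0.
  by rewrite !insubT /= => /(can_inj enK) [].
have := gE' q f0; rewrite (orient_ext (g := f0)); last by move=> i _ /=; rewrite gq.
rewrite -[LHS]mulr1 => /(mulfI f00) /esym E; apply: etrans E.
by rewrite -exprM -[RHS]signr_odd oddM oq andbT oddb.
Qed.

End Orientation.

Section Coboundary.
Variables (R : comPzRingType) (V : Type).
Implicit Types (c : (nat -> V) -> R) (P : nat -> V).

Definition shift a P : nat -> V := fun i => P (a + i)%N.

Definition coboundary n c P : R := \sum_(i < n.+1) (-1) ^+ i * c (P \o bump i).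

Definition local n c := forall P Q, (forall i, (i < n)%N -> P i = Q i) -> c P = c Q.

Definition cup a c1 c2 : (nat -> V) -> R := fun P => c1 P * c2 (shift a P).

(** The Leibniz rule: the term that omits vertex a + 1 in the first factor cancels
    the term that omits the first vertex of the second factor. *)
Lemma coboundary_cup a b c1 c2 P : local a.+1 c1 -> local b.+1 c2 ->
  coboundary (a + b).+1 (cup a c1 c2) P =
  coboundary a.+1 c1 P * c2 (shift a.+1 P) +
  (-1) ^+ a * c1 P * coboundary b.+1 c2 (shift a P).
Proof.
move=> l1 l2; have E1 i : (i < a.+1)%N ->
    cup a c1 c2 (P \o bump i) = c1 (P \o bump i) * c2 (shift a.+1 P).
  move=> ia; congr (_ * _); apply: l2 => j _; rewrite /shift /= /bump.
  by rewrite (leq_trans (ltnSE ia)) ?leq_addr.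
have E2 i : cup a c1 c2 (P \o bump (a.+1 + i)) = c1 P * c2 (shift a P \o bump i.+1).
  congr (_ * _).
    by apply: l1 => j ja /=; rewrite /bump leqNgt ltn_addr.
  by apply: l2 => j _; rewrite /shift /= /bump addSnnS leq_add2l addnCA.
rewrite /coboundary (_ : (a + b).+2 = a.+1 + b.+1)%N; last by rewrite addSn addnS.
rewrite big_split_ord /=.
rewrite (eq_bigr (fun i : 'I_a.+1 => (-1) ^+ i * c1 (P \o bump i) * c2 (shift a.+1 P))); last first.
  by move=> i _; rewrite E1 // mulrA.
rewrite (eq_bigr (fun i : 'I_b.+1 =>
    (-1) ^+ a.+1 * c1 P * ((-1) ^+ i * c2 (shift a P \o bump i.+1)))); last first.
  move=> i _; rewrite E2 exprD -!mulrA; congr (_ * _).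
  exact: mulrCA.
rewrite -mulr_suml -mulr_sumr.
rewrite [in RHS]big_ord_recr /= mulrDl [X in _ = _ + _ * X]big_ord_recl /= expr0 mul1r mulrDr.
have -> : c1 (P \o bump a.+1) = c1 P.
  by apply: l1 => i ia /=; rewrite /bump leqNgt ia.
have -> : c2 (shift a P \o bump 0) = c2 (shift a.+1 P).
  by apply: l2 => i _; rewrite /shift /= /bump /= add1n addnS addSn.
have -> : \sum_(i < b.+1) (-1) ^+ bump 0 i * c2 (shift a P \o bump (bump 0 i)) =
    - \sum_(i < b.+1) (-1) ^+ i * c2 (shift a P \o bump i.+1).
  by rewrite -sumrN; apply: eq_bigr => i _; rewrite exprS mulN1r mulNr.
rewrite exprS; ring.
Qed.

Lemma local_cup a b c1 c2 : local a.+1 c1 -> local b.+1 c2 -> local (a + b).+1 (cup a c1 c2).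
Proof.
move=> l1 l2 P Q PQ; congr (_ * _).
  by apply: l1 => i ia; apply: PQ; rewrite (leq_trans ia) // ltnS leq_addr.
by apply: l2 => i ib; apply: PQ; rewrite ltnS leq_add2l -ltnS.
Qed.

End Coboundary.

Section LabelCochain.
Variables (F : fieldType) (q : nat).

(** The cochain that detects simplices carrying all the labels.  It is the pullback
    of the top simplex of a labelled simplex, and represents the Euler class of the
    reduced regular representation. *)
Definition degree_form (f : nat -> 'I_q.+1) : F := orient F (@id 'I_q.+1) f.

Definition facet_form (f : nat -> 'I_q.+1) : F :=
  \det (\matrix_(i < q, c < q) (f i == lift ord0 c)%:R).

Lemma sum_indicator (c0 : 'I_q.+1) : \sum_(c < q.+1) (c0 == c)%:R = 1 :> F.
Proof.
rewrite (bigD1 c0) //= eqxx big1 ?addr0 // => c; rewrite eq_sym.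
by move=> /negbTE ->.
Qed.

(** Each row of the indicator matrix sums to 1.  Adding all columns to the first one
    makes it constant, and the expansion along it is the coboundary.  The primitive
    [facet_form] singles out the label 0, so it is not invariant under shifts. *)
Lemma degree_form_coboundary f : degree_form f = coboundary q facet_form f.
Proof.
pose U : 'M[F]_q.+1 := \matrix_(i, c) ((c == ord0) || (i == c))%:R.
have detU : \det U = 1.
  rewrite det_trig; first by rewrite big1 // => i _; rewrite mxE eqxx orbT.
  apply/is_trig_mxP => i c ic; rewrite mxE; case: eqP => [c0|_] /=.
    by rewrite c0 in ic.
  by rewrite -val_eqE ltn_eqF.
pose X := indicator_mx F (@id 'I_q.+1) q.+1 f *m U.
have X0 i : X i ord0 = 1.
  rewrite mxE -[RHS](sum_indicator (f i)); apply: eq_bigr => c _.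
  by rewrite !mxE eqxx mulr1.
have XS i c : X i (lift ord0 c) = (f i == lift ord0 c)%:R.
  rewrite mxE (bigD1 (lift ord0 c)) //= !mxE eqxx orbT mulr1.
  rewrite big1 ?addr0 // => c' /negbTE c'c; rewrite !mxE c'c.
  by rewrite (_ : lift ord0 c == ord0 = false) // mulr0.
have -> : degree_form f = \det X by rewrite det_mulmx detU mulr1.
rewrite (expand_det_col _ ord0); apply: eq_bigr => i _.
rewrite X0 mul1r /cofactor addn0; congr (_ * \det _).
by apply/matrixP => a c; rewrite [LHS]mxE [LHS]mxE XS [RHS]mxE.
Qed.

(** The alternating sum is the determinant of the indicator matrix bordered by a
    column of ones, which is the sum of the other columns. *)
Lemma degree_form_closed f : coboundary q.+1 degree_form f = 0.
Proof.
pose X : 'M[F]_q.+2 := \matrix_(i, c) (if unlift ord0 c is Some c' then (f i == c')%:R else 1).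
have <- : \det X = coboundary q.+1 degree_form f.
  rewrite (expand_det_col _ ord0); apply: eq_bigr => i _.
  rewrite mxE unlift_none mul1r /cofactor addn0; congr (_ * \det _).
  by apply/matrixP => a c; rewrite !mxE liftK.
apply/eqP; apply: contraT => dX.
pose x : 'cV[F]_q.+2 := \col_c (if c == ord0 then 1 else -1).
have Xx : X *m x = 0.
  apply/colP => i; rewrite !mxE big_ord_recl !mxE unlift_none /= mulr1.
  rewrite (eq_bigr (fun c => - (f i == c)%:R)) ?sumrN ?sum_indicator ?subrr // => c _.
  by rewrite !mxE liftK (_ : lift ord0 c == ord0 = false) // mulrN1.
have : x = 0 by rewrite -[x]mul1mx -(@mulVmx _ _ X) ?unitmxE ?unitfE // -mulmxA Xx mulmx0.
by move=> /matrixP /(_ ord0 0); rewrite !mxE eqxx => /eqP; rewrite oner_eq0.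
Qed.

Lemma local_degree_form : local q.+1 degree_form.
Proof. by move=> P Q PQ; apply: orient_ext. Qed.

Lemma local_facet_form : local q facet_form.
Proof.
by move=> P Q PQ; congr (\det _); apply/matrixP => i c; rewrite !mxE PQ.
Qed.

End LabelCochain.

(** * Summation by parts for alternating lattice chains *)

Section Stokes.
Variables (F : fieldType) (I : finType) (n : nat) (en : 'I_n -> I) (rk : I -> 'I_n).
Hypotheses (enK : cancel en rk) (rkK : cancel rk en).
Variables (x0 : I) (V : finZmodType) (dl : I -> V).

Local Notation W := {ffun 'I_n -> I}.
Implicit Types (w : W) (v : V).

(** A word is indexed by ordinals; reading it at natural numbers keeps the
    arithmetic of positions in nat. *)
Definition entry w a : I := if insub a is Some i then w i else x0.

Definition swap_entries a b w : W := [ffun i : 'I_n => entry w (swap a b i)].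

Lemma entry_ord w (i : 'I_n) : entry w i = w i.
Proof. by rewrite /entry insubT //= => H; congr (w _); apply: val_inj. Qed.

Lemma entry_swap a b w i : (a < n)%N -> (b < n)%N ->
  entry (swap_entries a b w) i = entry w (swap a b i).
Proof.
move=> an bn; have [ltin|geni] := ltnP i n.
  by rewrite -[i]/(val (Ordinal ltin)) entry_ord ffunE.
rewrite /swap !gtn_eqF ?(leq_trans _ geni) //.
by rewrite /entry insubF ?ltnNge ?geni // .
Qed.

Lemma swap_entriesK a b : (a < n)%N -> (b < n)%N -> involutive (swap_entries a b).
Proof.
move=> an bn w; apply/ffunP => i.
by rewrite ffunE entry_swap // swapK entry_ord.
Qed.

(** A word w lists all n directions, once each when it counts.  Its first letters are
    the directions normal to a lattice chain and the remaining ones are the successive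
    steps of a simplex that starts at v.  So if X v w is the coefficient of a chain,
    which may depend on v and on the normal letters, times the value of a cochain on
    the simplex, this sum evaluates the cochain on the chain.  Because the orientation
    is alternating in the letters, no further sign is needed. *)
Definition pairing (X : V -> W -> F) : F :=
  \sum_(w : W) \sum_(v : V) orient F en (entry w) * X v w.

Lemma pairing_ext X Y : (forall v w, injective w -> X v w = Y v w) ->
  pairing X = pairing Y.
Proof.
move=> XY; apply: eq_bigr => w _; apply: eq_bigr => v _.
have [->|o0] := eqVneq (orient F en (entry w)) 0; first by rewrite !mul0r.
rewrite XY // => i j; rewrite -!entry_ord => /(orient_inj o0) H.
by apply: val_inj; apply: H; rewrite inE.
Qed.

Lemma pairingD X Y : pairing (fun v w => X v w + Y v w) = pairing X + pairing Y.
Proof.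
rewrite -big_split; apply: eq_bigr => w _; rewrite -big_split; apply: eq_bigr => v _.
exact: mulrDr.
Qed.

Lemma pairingZ c X : pairing (fun v w => c * X v w) = c * pairing X.
Proof.
rewrite mulr_sumr; apply: eq_bigr => w _; rewrite mulr_sumr; apply: eq_bigr => v _.
exact: mulrCA.
Qed.

Lemma pairingN X : pairing (fun v w => - X v w) = - pairing X.
Proof. by rewrite -mulN1r -pairingZ; apply: pairing_ext => v w _; rewrite mulN1r. Qed.

Lemma pairing_sum (J : finType) (X : J -> V -> W -> F) :
  pairing (fun v w => \sum_j X j v w) = \sum_j pairing (X j).
Proof.
rewrite exchange_big; apply: eq_bigr => w _; rewrite exchange_big; apply: eq_bigr => v _.
exact: mulr_sumr.
Qed.

Lemma pairing_swap a b X : (a < n)%N -> (b < n)%N -> a != b ->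
  pairing (fun v w => X v (swap_entries a b w)) = - pairing X.
Proof.
move=> an bn ab; rewrite [in RHS]/pairing.
rewrite (reindex_inj (can_inj (swap_entriesK an bn))) -sumrN.
apply: eq_bigr => w _; rewrite -sumrN; apply: eq_bigr => v _.
rewrite -mulNr -(orient_swap _ en _ an bn ab); congr (_ * _); apply: orient_ext => i _ /=.
by rewrite entry_swap // swapK.
Qed.

Lemma pairing_shift (s : W -> V) X :
  pairing (fun v w => X (v + s w) w) = pairing X.
Proof.
by apply: eq_bigr => w _; rewrite [RHS](reindex_inj (addIr (s w))).
Qed.

Lemma pairing_reindex (h : W -> W) (g : V -> V) X : injective h -> injective g ->
  (forall w, orient F en (entry (h w)) = orient F en (entry w)) ->
  pairing X = pairing (fun v w => X (g v) (h w)).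
Proof.
move=> hi gi oh; rewrite [LHS](reindex_inj hi); apply: eq_bigr => w _.
by rewrite [LHS](reindex_inj gi); apply: eq_bigr => v _; rewrite oh.
Qed.

Hypothesis two0 : (2%:R : F) != 0.

Lemma pairing_sym0 a b X : (a < n)%N -> (b < n)%N -> a != b ->
  (forall v w, X v (swap_entries a b w) = X v w) -> pairing X = 0.
Proof.
move=> an bn ab Xs; have := pairing_swap X an bn ab.
have -> : pairing (fun v w => X v (swap_entries a b w)) = pairing X.
  by apply: pairing_ext => v w _.
move/eqP; rewrite -addr_eq0 -mulr2n -mulr_natl mulf_eq0 (negbTE two0) /=.
by move/eqP.
Qed.

Definition lattice_path v (u : nat -> I) (k : nat) : V := v + \sum_(i < k) dl (u i).

Lemma lattice_path_eq v u u' k : (forall i, (i < k)%N -> u i = u' i) -> lattice_path v u k = lattice_path v u' k.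
Proof. by move=> uu; congr (_ + _); apply: eq_bigr => i _; rewrite uu. Qed.

Lemma lattice_path_swap v u i k : k != i.+1 -> lattice_path v (u \o swap i i.+1) k = lattice_path v u k.
Proof.
move=> ki; congr (_ + _).
have [lt|ge] := ltnP k i.+1.
  apply: eq_bigr => a _; rewrite /= /swap !ltn_eqF //.
    by rewrite (leq_trans (ltn_ord a)) // -ltnS (leq_trans lt).
  by rewrite (leq_trans (ltn_ord a)).
have {ki ge} ik : (i.+1 < k)%N by rewrite ltn_neqAle eq_sym ki.
rewrite -(big_mkord xpredT (fun a => dl ((u \o swap i i.+1) a))) -(big_mkord xpredT (fun a => dl (u a))).
have ik0 : (i <= k)%N by apply: ltnW (ltnW ik).
rewrite [LHS](@big_cat_nat _ _ _ i) // [RHS](@big_cat_nat _ _ _ i) //=.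
rewrite !(@big_ltn _ _ _ i) ?(ltnW ik) // !(@big_ltn _ _ _ i.+1) //=.
rewrite /swap !eqxx (gtn_eqF (ltnSn i)).
congr (_ + _).
  apply: eq_big_nat => a /andP[_ ai]; rewrite !ltn_eqF //; exact: leq_trans ai _.
rewrite addrCA; congr (_ + (_ + _)).
by apply: eq_big_nat => a /andP[ai _]; rewrite !gtn_eqF // (ltn_trans _ ai).
Qed.

Variables (M : nat) (pos : nat -> nat) (beta : V -> W -> F) (E : (nat -> V) -> F).
Hypotheses (pos_lt : forall i, (i < M.+1)%N -> (pos i < n)%N).
Hypotheses (pos_inj : {in gtn M.+1 &, injective pos}).
Hypotheses (beta_swap : forall a b v w, (a < M.+1)%N -> (b < M.+1)%N ->
  beta v (swap_entries (pos a) (pos b) w) = beta v w).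
Hypotheses (local_E : local M.+1 E).

Local Notation dirs w := (fun i => entry w (pos i)).

Lemma dirs_swap a b w i : (a < M.+1)%N -> (b < M.+1)%N -> (i < M.+1)%N ->
  dirs (swap_entries (pos a) (pos b) w) i = dirs w (swap a b i).
Proof.
move=> aM bM iM; rewrite /= entry_swap ?pos_lt // /swap !(inj_in_eq pos_inj) //.
by case: ifP => // _; case: ifP.
Qed.

(** Evaluating a coboundary on a chain is evaluating the cochain on the boundary.
    Expand the coboundary.  Omitting an inner vertex gives a term that is symmetric in
    two consecutive steps, so it cancels.  Omitting the first vertex moves the base
    point by one step.  Omitting the last one drops the last step, and moving that
    letter to the front by transpositions gives the same simplex without its first
    direction.  The coefficient beta may depend on the letters outside pos. *)
Lemma stokes :
  pairing (fun v w => beta v w * coboundary M.+1 E (lattice_path v (dirs w))) =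
  pairing (fun v w => (beta (v - dl (entry w (pos 0))) w - beta v w)
                      * E (lattice_path v (fun i => entry w (pos i.+1)))).
Proof.
pose T i := pairing (fun v w => beta v w * E (lattice_path v (dirs w) \o bump i)).
pose R a := pairing (fun v w => beta v w * E (lattice_path v (fun i => entry w (pos (bump a i))))).
have -> : pairing (fun v w => beta v w * coboundary M.+1 E (lattice_path v (dirs w))) =
    \sum_(i < M.+2) (-1) ^+ i * T i.
  under [RHS]eq_bigr => i _ do rewrite -pairingZ.
  rewrite -pairing_sum; apply: pairing_ext => v w _.
  rewrite mulr_sumr; apply: eq_bigr => i _; exact: mulrCA.
have Tmid i : (i < M)%N -> T i.+1 = 0.
  move=> iM; have i1 : (i < M.+1)%N := ltnW iM.
  apply: (@pairing_sym0 (pos i) (pos i.+1)); rewrite ?pos_lt //.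
    by rewrite (inj_in_eq pos_inj) ?inE // ltn_eqF.
  move=> v w; rewrite beta_swap //; congr (_ * _); apply: local_E => k kM /=.
  have nb : bump i.+1 k != i.+1 by rewrite eq_sym neq_bump.
  rewrite -[RHS](lattice_path_swap _ _ nb).
  apply: lattice_path_eq => a ak; apply: dirs_swap => //.
  apply: leq_trans ak _; rewrite /bump; lia.
have RS a : (a < M)%N -> R a.+1 = - R a.
  move=> aM; have a1 : (a < M.+1)%N := ltnW aM.
  rewrite -(@pairing_swap (pos a) (pos a.+1)) ?pos_lt //; last first.
    by rewrite (inj_in_eq pos_inj) ?inE // ltn_eqF.
  apply: pairing_ext => v w _; rewrite beta_swap //; congr (_ * _).
  apply: local_E => k kM /=; apply: lattice_path_eq => i ik.
  have bM : (bump a i < M.+1)%N by rewrite /bump; lia.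
  rewrite (@dirs_swap a a.+1 w _ a1 aM bM); congr (entry w (pos _)).
  by rewrite /swap /bump; repeat case: ifP; lia.
have RM : forall a, (a < M.+1)%N -> R a = (-1) ^+ a * R 0.
  elim=> [|a IH] aM; first by rewrite mul1r.
  by rewrite RS // IH ?(ltnW aM) // exprS mulN1r mulNr.
have TM : T M.+1 = R M.
  apply: pairing_ext => v w _; congr (_ * _); apply: local_E => k kM /=.
  rewrite /bump leqNgt kM /=; apply: lattice_path_eq => i ik; rewrite leqNgt.
  by rewrite (leq_trans ik).
rewrite big_ord_recr big_ord_recl /= mul1r TM RM // mulrA exprS mulN1r mulNr.
rewrite -expr2 -exprM muln2 -signr_odd odd_double mulN1r.
rewrite big1 ?addr0 => [|i _]; last by rewrite Tmid ?mulr0.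
rewrite -pairingN -[T 0%N](@pairing_shift (fun w => - dl (entry w (pos 0)))) -pairingD.
apply: pairing_ext => v w _; rewrite mulrBl -mulNr; congr (_ * _ + _ * _).
apply: local_E => k kM; rewrite /lattice_path /= /bump /= add1n big_ord_recl.
by rewrite addrA subrK.
Qed.

End Stokes.

(** * The Euler cocycle of a family of labellings *)

(* The finite and additive structures of a type of finite functions are joined here. *)
HB.instance Definition _ (I : finType) (T : finZmodType) := Finite.on {ffun I -> T}.

Section CupForm.
Variables (F : fieldType) (V : Type) (q : nat) (lab : nat -> V -> 'I_q.+2).
Implicit Types P : nat -> V.

Definition block_form j P : F := degree_form F (lab j \o P).

(** The Euler cocycle of j copies of the representation, for the labellings lab 0,
    ..., lab (j-1): consecutive blocks of vertices overlap in one vertex. *)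
Fixpoint cup_form j : (nat -> V) -> F :=
  if j is j'.+1 then cup (j' * q.+1) (cup_form j') (block_form j') else fun=> 1.

Lemma local_cup_form j : local (j * q.+1).+1 (cup_form j).
Proof.
elim: j => [|j IH]; first by [].
rewrite mulSn addnC; apply: local_cup => //.
by move=> P Q PQ; apply: local_degree_form => i iq /=; rewrite PQ.
Qed.

Lemma cup_form_closed j P : coboundary (j * q.+1).+1 (cup_form j) P = 0.
Proof.
elim: j P => [|j IH] P.
  by rewrite /coboundary !big_ord_recl big_ord0 /= !mulr1 addr0 addrN.
rewrite mulSn addnC coboundary_cup; first last.
- by move=> A B AB; apply: local_degree_form => i iq /=; rewrite AB.
- exact: local_cup_form.
rewrite IH mul0r add0r.
have -> : coboundary q.+2 (block_form j) (shift (j * q.+1) P) =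
    coboundary q.+2 (@degree_form F _) (lab j \o shift (j * q.+1) P) by [].
by rewrite degree_form_closed mulr0.
Qed.

Lemma cup_form_prod j P :
  cup_form j P = \prod_(a < j) block_form a (shift (a * q.+1) P).
Proof. by elim: j => [|j IH]; rewrite ?big_ord0 // big_ord_recr /= -IH. Qed.

(** Only the last factor is replaced by its primitive: the others are closed, so the
    coboundary of the product is the cocycle up to the Leibniz sign. *)
Definition cup_primitive j : (nat -> V) -> F := fun P => (-1) ^+ (j * q.+1) *
  cup (j * q.+1) (cup_form j) (fun P => facet_form F (lab j \o P)) P.

Lemma local_cup_primitive j : local (j.+1 * q.+1) (cup_primitive j).
Proof.
move=> P Q PQ; congr (_ * _); move: P Q PQ; rewrite mulSn addnC addnS.
apply: local_cup; first exact: local_cup_form.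
by move=> A B AB; apply: local_facet_form => i iq /=; rewrite AB.
Qed.

Lemma cup_primitive_coboundary j P :
  coboundary (j.+1 * q.+1) (cup_primitive j) P = cup_form j.+1 P.
Proof.
have -> : coboundary (j.+1 * q.+1) (cup_primitive j) P = (-1) ^+ (j * q.+1) *
    coboundary (j * q.+1 + q).+1
      (cup (j * q.+1) (cup_form j) (fun P => facet_form F (lab j \o P))) P.
  rewrite mulSn addnC addnS mulr_sumr; apply: eq_bigr => i _.
  by rewrite /cup_primitive mulrCA.
rewrite coboundary_cup; first last.
- by move=> A B AB; apply: local_facet_form => i iq /=; rewrite AB.
- exact: local_cup_form.
rewrite cup_form_closed mul0r add0r !mulrA -expr2 sqrr_sign mul1r /=.
by rewrite /cup /block_form degree_form_coboundary.
Qed.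

End CupForm.

(** * The cone and the slice on the grid torus *)

(** Distance at least k on the circle Z/8k, for representatives a and c. *)
Definition far (k a c : nat) := (k <= (a - c) + (c - a) <= 7 * k)%N.

(* The two sections that follow describe one coordinate t of R^d, that is, one circle
   Z/8k for each of the p points; u lists the representatives and j0 is the index of
   the distinguished point. *)
Section Numeric.
Variables (R : comPzRingType) (J : finType) (j0 : J) (k : nat) (u : J -> nat).
Hypotheses (k3 : (2 < k)%N) (u_lt : forall i, (u i < 8 * k)%N).
Hypothesis u_near : (u j0 <= 2 * k)%N -> forall i, ~~ far k (u i) (u j0).

Definition step_down (g i : J) : nat :=
  if i == g then (if (0 < u i)%N then (u i).-1 else (8 * k).-1) else u i.

Lemma near_cases : (u j0 <= 2 * k)%N -> forall i,
  ((u i < u j0 + k) && (u j0 < u i + k) || (u j0 + 7 * k < u i) || (u i + 7 * k < u j0))%N.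
Proof. by move=> u0 i; have := u_near u0 i; rewrite /far; lia. Qed.

(** The cone {u >= 0, min u = 0} and the slice {u_j0 = 0} differ by a boundary.  They
    are boundaries of the orthant and of the half space u_j0 >= 0, so a chain between
    them is carried by the part of the half space outside the orthant.  On the torus
    this region is cut off at 2k in the direction j0 and at 4k in the others, and the
    faces created by the cuts lie far from the diagonal. *)
Lemma homotopy_step g :
  ((step_down g j0 < 2 * k)%N && ~~ [forall i, (step_down g i < 4 * k)%N])%:R -
  ((u j0 < 2 * k)%N && ~~ [forall i, (u i < 4 * k)%N])%:R =
  ((u g == 0%N) && [forall i, (u i < 2 * k)%N])%:R - ((g == j0) && (u g == 0%N))%:R :> R.
Proof.
have nv := near_cases.
have [->|g0] := eqVneq g j0.
  rewrite {1}/step_down eqxx.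
  case: (posnP (u j0)) => [v0|v0].
    rewrite v0 ltnNge (_ : (2 * k <= (8 * k).-1)%N) /=; last by lia.
    rewrite (_ : 0 < 2 * k)%N /= ?eqxx /=; last by lia.
    rewrite (eq_forallb (P2 := fun i => (u i < 2 * k)%N)); last first.
      by move=> i /=; have := nv _ i; rewrite v0; lia.
    by case: [forall _, _]; rewrite /= ?subrr ?sub0r ?subr0.
  rewrite /= subr0.
  case: (ltngtP (u j0) (2 * k)) => [c|c|c].
  - rewrite (_ : (u j0).-1 < 2 * k)%N /=; last by lia.
    rewrite (eq_forallb (P2 := fun i => (u i < 4 * k)%N)) ?subrr //.
    by move=> i /=; rewrite /step_down; case: eqP => [->|//]; rewrite v0; lia.
  - by rewrite (_ : (u j0).-1 < 2 * k = false)%N ?subrr //; lia.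
  rewrite (_ : [forall i, _] = true) /= ?andbF ?subr0 //.
  apply/forallP => i; have := u_lt i; have := nv _ i; rewrite c /step_down leqnn => /(_ isT).
  by case: eqP => [->|_]; [rewrite c; case: ifP; lia | lia].
rewrite {1}/step_down [j0 == g]eq_sym (negbTE g0) subr0.
case: (ltnP (u j0) (2 * k)) => [c|c] /=; last first.
  rewrite subrr; case: forallP => [/(_ j0)|]; last by rewrite andbF.
  by rewrite ltnNge c.
have nv' := nv (ltnW c).
case: (posnP (u g)) => [v0|v0].
  rewrite (_ : [forall i, _] = false) /=; last first.
    by apply/forallP => /(_ g); rewrite /step_down eqxx v0 /=; lia.
  rewrite /= (eq_forallb (P2 := fun i => (u i < 2 * k)%N)).
    by case: [forall _, _]; rewrite /= ?subrr ?subr0.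
  by move=> i /=; have := nv' i; have := nv' g; rewrite v0; lia.
rewrite /= (eq_forallb (P2 := fun i => (u i < 4 * k)%N)) ?subrr //.
by move=> i /=; rewrite /step_down; case: eqP => [->|//]; rewrite v0; have := nv' g; lia.
Qed.

(** The boundary of the cone, near the diagonal.  The right-hand side is symmetric in
    the two directions, so alternation will cancel it. *)
Lemma corner_step g h : g != h ->
  ((step_down g h == 0%N) && [forall i, (step_down g i < 2 * k)%N])%:R -
  ((u h == 0%N) && [forall i, (u i < 2 * k)%N])%:R =
  - [&& u g == 0%N, u h == 0%N & [forall i, (u i < 2 * k)%N]]%:R :> R.
Proof.
move=> gh; have nv := near_cases.
rewrite {1}/step_down [h == g]eq_sym (negbTE gh).
case: (posnP (u h)) => [h0|h0]; last by rewrite /= !andbF subrr oppr0.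
rewrite /=.
case: (posnP (u g)) => [g0|g0].
  rewrite /= (_ : [forall i, _] = false) ?sub0r //.
  by apply/forallP => /(_ g); rewrite /step_down eqxx g0 /=; lia.
rewrite /= oppr0; apply/eqP; rewrite subr_eq0; apply/eqP; congr (_%:R); congr nat_of_bool.
apply/forallP/forallP => H i; last first.
  by have := H i; rewrite /step_down; case: eqP => [->|//]; case: ifP; lia.
have := H i; rewrite /step_down; case: eqP => [->|//]; rewrite g0.
have := H j0; rewrite /step_down; case: eqP => [E|_]; rewrite ?g0 => H0 H1.
  have Eu : u j0 = u g by rewrite E.
  by move: H0; rewrite Eu g0 => H0; have := nv _ h; rewrite Eu h0; lia.
by have := nv _ h; have := nv _ g; rewrite h0; lia.
Qed.

End Numeric.

Section TorusForms.
Variables (F : fieldType) (p D k : nat).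
Hypothesis k3 : (2 < k)%N.

Local Notation I := ('I_D * 'Z_p)%type.
Local Notation T := 'Z_(8 * k).
Local Notation V := {ffun 'I_D * 'Z_p -> 'Z_(8 * k)}.

Lemma Zm_trunc : (Zp_trunc (8 * k)).+2 = (8 * k)%N.
Proof. by rewrite Zp_cast //; lia. Qed.

Lemma Zm_lt (x : T) : (x < 8 * k)%N.
Proof. by apply: leq_trans (ltn_ord x) _; rewrite Zm_trunc. Qed.

Lemma Zm_val1 : (1 : T) = 1%N :> nat.
Proof. by []. Qed.

Lemma Zm_valB (x y : T) : (x - y : T) = (if (y <= x)%N then x - y else x + 8 * k - y)%N :> nat.
Proof.
have := Zm_lt x; have := Zm_lt y; rewrite /=.
move: (nat_of_ord x) (nat_of_ord y) => {}x {}y; rewrite !Zm_trunc modnDmr => y8 x8.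
case: leqP => yx.
  by rewrite addnBA 1?ltnW // addnC -addnBA // modnDl modn_small //; lia.
by rewrite addnBA 1?ltnW // modn_small //; lia.
Qed.

Lemma Zm_valD1 (x : T) : (x + 1 : T) = (if (x.+1 < 8 * k)%N then x.+1 else 0)%N :> nat.
Proof.
have := Zm_lt x; rewrite /=; move: (nat_of_ord x) => {}x; rewrite Zm_trunc modnDmr addn1 => x9.
case: ltnP => x8; first by rewrite modn_small.
by rewrite (_ : x.+1 = 8 * k)%N ?modnn //; lia.
Qed.

Definition unit_step (x : I) : V := [ffun y => (y == x)%:R].

Lemma subr_step (v : V) x y : (v - unit_step x) y = v y - (y == x)%:R.
Proof. by rewrite !ffunE. Qed.

(** Coefficients of chains of codimension 1 in the s-th product of p circles, as
    functions of the base point v and of the normal direction x; [corner_form] is the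
    cone and [slice_form] is the slice.  The bound 2k keeps the first point inside the
    cube on which the map to the sphere is injective. *)
Definition corner_form (s : 'I_D) (v : V) (x : I) : F :=
  [&& x.1 == s, v x == 0 & [forall i, (v (s, i) < 2 * k)%N]]%:R.

Definition slice_form (s : 'I_D) (v : V) (x : I) : F :=
  ((x == (s, 0%R)) && (v x == 0))%:R.

(** A chain of full dimension whose boundary is the difference of the cone and the
    slice near the diagonal, in the sense of [homotopy_step]. *)
Definition homotopy_form (s : 'I_D) (v : V) : F :=
  ((v (s, 0%R) < 2 * k)%N && ~~ [forall i, (v (s, i) < 4 * k)%N])%:R.

Definition block_near (s : 'I_D) (v : V) :=
  (v (s, 0%R) <= 2 * k)%N -> forall i, ~~ far k (v (s, i)) (v (s, 0%R)).

Lemma homotopy_boundary s v x : block_near s v -> x.1 = s ->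
  homotopy_form s (v - unit_step x) - homotopy_form s v =
  corner_form s v x - slice_form s v x.
Proof.
case: x => s' g nv /= ->; rewrite /homotopy_form /corner_form /slice_form.
have E (y : T) : (y == 0) = ((y : nat) == 0%N) by rewrite -val_eqE.
rewrite /= !eqxx /= !E.
have B i : (v - unit_step (s, g)) (s, i) =
    (if i == g then (if (0 < v (s, i))%N then (v (s, i)).-1 else (8 * k).-1) else v (s, i))%N :> nat.
  rewrite subr_step xpair_eqE eqxx andTb; case: eqP => _; last by rewrite mulr0n subr0.
  by rewrite mulr1n Zm_valB Zm_val1; case: ifP => ?; lia.
rewrite (eq_forallb (P2 := fun i => (step_down k (fun i => v (s, i)) g i < 4 * k)%N)); last first.
  by move=> i /=; rewrite B.
rewrite B xpair_eqE eqxx /=.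
by apply: (@homotopy_step _ _ 0 k (fun i => v (s, i))) => // i; exact: Zm_lt.
Qed.

Lemma corner_boundary s v x y : block_near s v -> x != y -> x.1 = s -> y.1 = s ->
  corner_form s (v - unit_step x) y - corner_form s v y =
  - [&& v x == 0, v y == 0 & [forall i, (v (s, i) < 2 * k)%N]]%:R.
Proof.
case: x y => [s1 g] [s2 h] nv xy /= s1E s2E; move: xy; rewrite {s1}s1E {s2}s2E.
rewrite xpair_eqE eqxx /= => gh; rewrite /corner_form.
have E (z : T) : (z == 0) = ((z : nat) == 0%N) by rewrite -val_eqE.
rewrite /= !eqxx /= !E.
have B i : (v - unit_step (s, g)) (s, i) =
    (if i == g then (if (0 < v (s, i))%N then (v (s, i)).-1 else (8 * k).-1) else v (s, i))%N :> nat.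
  rewrite subr_step xpair_eqE eqxx andTb; case: eqP => _; last by rewrite mulr0n subr0.
  by rewrite mulr1n Zm_valB Zm_val1; case: ifP => ?; lia.
rewrite (eq_forallb (P2 := fun i => (step_down k (fun i => v (s, i)) g i < 2 * k)%N)); last first.
  by move=> i /=; rewrite B.
rewrite B.
by apply: (@corner_step _ _ 0 k (fun i => v (s, i))) => // i; exact: Zm_lt.
Qed.

End TorusForms.

(** * Without zeros, the apex of the cone contributes nothing *)

Section TorusPairing.
Variables (p D' k : nat).
Hypotheses (p_prime : prime p) (p_odd : odd p) (k3 : (2 < k)%N).

Local Opaque entry swap_entries.

Local Notation D := D'.+1.
Local Notation I := ('I_D'.+1 * 'Z_p)%type.
Local Notation T := 'Z_(8 * k).
Local Notation V := {ffun 'I_D'.+1 * 'Z_p -> 'Z_(8 * k)}.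
Local Notation F := 'F_p.
Local Notation n := #|{: 'I_D'.+1 * 'Z_p}|.
Local Notation W := {ffun 'I_#|{: 'I_D'.+1 * 'Z_p}| -> 'I_D'.+1 * 'Z_p}.
Local Notation q := (Zp_trunc p).+1.
Local Notation step := (@unit_step p D'.+1 k).

Let x0 : I := (ord0, 0).
Let en (i : 'I_n) : I := enum_val i.
Let rk (x : I) : 'I_n := enum_rank x.
Let enK : cancel en rk. Proof. exact: enum_valK. Qed.
Let rkK : cancel rk en. Proof. exact: enum_rankK. Qed.

Lemma Zp_card : q.+1 = p.
Proof. by rewrite Zp_cast // prime_gt1. Qed.

Lemma card_directions : n = (D + D * q)%N.
Proof. by rewrite card_prod !card_ord -mulnS. Qed.

Lemma two_neq0 : (2%:R : F) != 0.
Proof.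
have cF := pchar_Fp p_prime.
rewrite -(dvdn_pcharf cF); apply: contraL p_odd => p2.
by rewrite (eqP (_ : p == 2%N)) // -(dvdn_prime2 p_prime).
Qed.

Lemma p_natr_eq0 : (p%:R : F) = 0.
Proof. exact: (pcharf0 (pchar_Fp p_prime)). Qed.

Definition torus_pairing : (V -> W -> F) -> F := pairing (V := V) en x0.

(** In the coordinates below t the cone has already been replaced by the slice.  The
    first D letters of w are the normal directions, one for each coordinate of R^D. *)
Definition mixed_factor t (v : V) (w : W) (s : 'I_D) : F :=
  if (s < t)%N then slice_form F s v (entry x0 w s) else corner_form F s v (entry x0 w s).

Definition mixed_form t v w : F := \prod_s mixed_factor t v w s.

Variable lab : nat -> V -> 'Z_p.

Definition euler_form v (w : W) : F :=
  cup_form F lab D (lattice_path step v (fun i => entry x0 w (D + i))).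

Lemma euler_form_ext v (w w' : W) :
  (forall i, (i < D * q)%N -> entry x0 w (D + i) = entry x0 w' (D + i)) ->
  euler_form v w = euler_form v w'.
Proof.
move=> ww; apply: local_cup_form => i iN; apply: lattice_path_eq => a ai; apply: ww.
by rewrite (leq_trans ai).
Qed.

Lemma entry_inj (w : W) i j : injective w -> (i < n)%N -> (j < n)%N ->
  entry x0 w i = entry x0 w j -> i = j.
Proof.
move=> wi ilt jlt; rewrite -[i]/(val (Ordinal ilt)) -[j]/(val (Ordinal jlt)).
by rewrite !entry_ord => /wi ->.
Qed.

Lemma mixed_factor_ext t (v v' : V) (w : W) (s : 'I_D) : (forall i, v (s, i) = v' (s, i)) ->
  mixed_factor t v w s = mixed_factor t v' w s.
Proof.
move=> vv; rewrite /mixed_factor /slice_form /corner_form.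
case: (entry x0 w s) => s' g /=; case: ifP => _.
  by rewrite xpair_eqE; case: eqP => [->|//]; rewrite vv.
case: eqP => [->|//]; rewrite vv (eq_forallb (P2 := fun i => (v' (s, i) < 2 * k)%N)) // => i.
by rewrite vv.
Qed.

Lemma mixed_factor_neq0 t (v : V) (w : W) (s : 'I_D) : mixed_factor t v w s != 0 -> (v (s, 0%R) <= 2 * k)%N.
Proof.
rewrite /mixed_factor /slice_form /corner_form; case: ifP => _.
  case: (entry x0 w s =P (s, 0%R)) => [->|_]; last by rewrite mulr0n eqxx.
  by case: (v (s, 0%R) =P 0) => [->|_] //; rewrite mulr0n eqxx.
case: forallP => [/(_ 0%R)/ltnW //|]; by rewrite !andbF mulr0n eqxx.
Qed.

(* This is the negation of the conclusion aimed at, in cohomological form. *)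
Hypothesis euler_form_far : forall (v : V) (w : W), injective w -> (forall s, v (s, 0%R) <= 2 * k)%N ->
  (exists s i, far k (v (s, i)) (v (s, 0%R))) -> euler_form v w = 0.

Lemma euler_form_near (v : V) (w : W) : injective w -> (forall s, v (s, 0%R) <= 2 * k)%N ->
  euler_form v w != 0 -> forall s i, ~~ far k (v (s, i)) (v (s, 0%R)).
Proof.
move=> wi v0 e0 s i; apply: contra e0 => f; apply/eqP; apply: euler_form_far => //.
by exists s, i.
Qed.

(** Apply [stokes] to the product of the factors s <> t with [homotopy_form] at t; the
    left-hand side is zero as the Euler cocycle is closed.  On the right, steps in
    coordinate t give the difference of cone and slice.  Steps in a coordinate s <> t
    see the boundary of the s-th factor.  For s < t the slice is closed and nothing
    remains.  For s > t the boundary of the cone is symmetric in letters t and s, and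
    the pairing is alternating. *)
Lemma mixed_step t : (t < D)%N ->
  torus_pairing (fun v w => mixed_form t v w * euler_form v w) =
  torus_pairing (fun v w => mixed_form t.+1 v w * euler_form v w).
Proof.
move=> tD; pose tt := Ordinal tD.
have ltn_n i : (i < D)%N -> (i < n)%N.
  by move=> iD; rewrite card_directions (leq_trans iD) ?leq_addr.
pose beta (v : V) (w : W) : F := (\prod_(s | s != tt) mixed_factor t v w s) * homotopy_form F tt v.
pose dbeta (v : V) (w : W) : F := beta (v - step (entry x0 w t)) w - beta v w.
pose pos i := if i is i'.+1 then (D + i')%N else t.
have pos_lt i : (i < (D * q).+1)%N -> (pos i < n)%N.
  case: i => [|i] /= iN; first exact: ltn_n.
  by rewrite card_directions ltn_add2l.
have pos_inj : {in gtn (D * q).+1 &, injective pos}.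
  move=> [|i] [|j] //= _ _ E.
  - by have := tD; rewrite E ltnNge leq_addr.
  - by have := tD; rewrite -E ltnNge leq_addr.
  - by move/addnI: E => ->.
have swap_other a b (s : 'I_D) : (a < (D * q).+1)%N -> (b < (D * q).+1)%N -> s != tt ->
    forall w : W, entry x0 (swap_entries x0 (pos a) (pos b) w) s = entry x0 w s.
  move=> aN bN st w; rewrite entry_swap ?pos_lt // /swap.
  have N i : (i < (D * q).+1)%N -> (s == pos i :> nat) = false.
    case: i => [|i] _ /=; first by rewrite -(negbTE st).
    by apply/eqP => E; have := ltn_ord s; rewrite E ltnNge leq_addr.
  by rewrite !N.
have beta_swap : forall (a b : nat) (v : V) (w : W), (a < (D * q).+1)%N -> (b < (D * q).+1)%N ->
    beta v (swap_entries x0 (pos a) (pos b) w) = beta v w.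
  move=> a b v w aN bN; congr (_ * _); apply: eq_bigr => s st.
  by rewrite /mixed_factor swap_other.
have St := @stokes F I n en x0 V step two_neq0 (D * q) pos beta
  (cup_form F lab D) pos_lt pos_inj beta_swap (@local_cup_form F V _ lab D).
have {St} : torus_pairing (fun v w => dbeta v w * euler_form v w) = 0.
  rewrite -[LHS]St -[RHS](mul0r (torus_pairing (fun _ _ => 0))) -[RHS]pairingZ.
  by apply: pairing_ext => v w _; rewrite cup_form_closed mulr0 mul0r.
pose X (s : 'I_D) (v : V) (w : W) : F := (if (entry x0 w t).1 == s then dbeta v w * euler_form v w else 0 : F).
have -> : torus_pairing (fun v w => dbeta v w * euler_form v w) = \sum_s torus_pairing (X s).
  rewrite -[RHS]pairing_sum; apply: pairing_ext => v w _.
  rewrite (bigD1 (entry x0 w t).1) //= /X eqxx big1 ?addr0 // => s.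
  by rewrite eq_sym => /negbTE ->.
have step_other (v : V) (x : I) (s : 'I_D) i : x.1 != s -> (v - step x) (s, i) = v (s, i).
  move=> xs; rewrite subr_step (_ : (s, i) == x = false) ?subr0 //.
  by apply: contraNF xs => /eqP <-.
rewrite (bigD1 tt) //= big1 ?addr0 => [|s st]; last first.
  have ts_n : (t < n)%N := ltn_n _ tD.
  have ss_n : (s < n)%N := ltn_n _ (ltn_ord s).
  have t_s : t != s by rewrite eq_sym.
  have betaE (v : V) (w : W) : beta v w = mixed_factor t v w s *
     (\prod_(s' | (s' != tt) && (s' != s)) mixed_factor t v w s' * homotopy_form F tt v).
    by rewrite /beta (bigD1 s) //= mulrA.
  pose rest (v : V) (w : W) : F := \prod_(s' | (s' != tt) && (s' != s)) mixed_factor t v w s' *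
       homotopy_form F tt v.
  have restE (v : V) (w : W) (x : I) : x.1 = s -> rest (v - step x) w = rest v w.
    move=> xs; congr (_ * _).
      apply: eq_bigr => s' /andP[_ s's]; apply: mixed_factor_ext => i.
      by rewrite step_other // xs eq_sym.
    rewrite /homotopy_form step_other ?xs // (eq_forallb (P2 := fun i => (v (tt, i) < 4 * k)%N)) //.
    by move=> i; rewrite step_other ?xs.
  pose Y (v : V) (w : W) : F := (if ((entry x0 w t).1 == s) && ((entry x0 w s).1 == s) then
      - [&& v (entry x0 w t) == 0, v (entry x0 w s) == 0 &
          [forall i, (v (s, i) < 2 * k)%N]]%:R * rest v w * euler_form v w else 0 : F).
  have [lt_st|ge_st] := ltnP s t.
    rewrite -[RHS](mul0r (torus_pairing (fun _ _ => 0))) -[RHS]pairingZ.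
    apply: pairing_ext => v w wi; rewrite mul0r /X; case: eqP => // xs.
    rewrite /dbeta !betaE -!/(rest _ _) restE // -mulrBl.
    rewrite /mixed_factor lt_st /slice_form subr_step.
    rewrite (_ : entry x0 w s == entry x0 w t = false) ?subr0 ?subrr ?mul0r //.
    by apply: contraNF t_s => /eqP /entry_inj ->.
  have -> : torus_pairing (X s) = torus_pairing Y.
    apply: pairing_ext => v w wi; rewrite /X /Y; case: eqP => //= xs.
    have [e0|e0] := eqVneq (euler_form v w) 0; first by rewrite e0 !mulr0 if_same.
    rewrite /dbeta !betaE -!/(rest _ _) restE // -mulrBl.
    have [r0|r0] := eqVneq (rest v w) 0.
      by rewrite r0 !mulr0 mul0r if_same.
    rewrite /mixed_factor ltnNge ge_st /=.
    case: eqP => ys; last by rewrite /corner_form; case: eqP => //; rewrite subrr !mul0r.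
    rewrite corner_boundary //.
      move=> v0 i; apply: (euler_form_near wi _ e0) => s'.
      have [->//|s's] := eqVneq s' s.
      have [->|s't] := eqVneq s' tt.
        move: r0; rewrite mulf_eq0 negb_or => /andP[_].
        rewrite /homotopy_form; by case: ltnP => [/ltnW//|_]; rewrite mulr0n eqxx.
      apply: (@mixed_factor_neq0 t _ w); apply: contraNneq r0 => r0.
      by rewrite /rest (bigD1 s') /= ?s's ?s't // r0 !mul0r.
    by apply: contraNneq t_s => /entry_inj ->.
  have := @pairing_sym0 F I n en x0 V two_neq0 t s Y ts_n ss_n t_s; apply => v w.
  have Et : entry x0 (swap_entries x0 t s w) t = entry x0 w s.
    by rewrite entry_swap // /swap eqxx.
  have Es : entry x0 (swap_entries x0 t s w) s = entry x0 w t.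
    by rewrite entry_swap // swapC /swap eqxx.
  have Eo i : i != t -> i != s -> entry x0 (swap_entries x0 t s w) i = entry x0 w i.
    by move=> it is_; rewrite entry_swap // /swap (negbTE it) (negbTE is_).
  have Er : rest v (swap_entries x0 t s w) = rest v w.
    congr (_ * _); apply: eq_bigr => s' /andP[s't s's].
    by rewrite /mixed_factor Eo.
  have Ee : euler_form v (swap_entries x0 t s w) = euler_form v w.
    apply: euler_form_ext => i iN; apply: Eo.
      by rewrite gtn_eqF // (leq_trans tD) ?leq_addr.
    by rewrite gtn_eqF // (leq_trans (ltn_ord s)) ?leq_addr.
  by rewrite /Y Et Es Er Ee [in LHS]andbC [in LHS]andbCA.
move=> X0; apply/eqP; rewrite -subr_eq0 -X0 -[torus_pairing _ - _]/(_ + - _) /torus_pairing -pairingN -pairingD.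
apply/eqP; apply: pairing_ext => v w wi.
have split t' : mixed_form t' v w = mixed_factor t' v w tt *
    \prod_(s | s != tt) mixed_factor t' v w s by rewrite /mixed_form (bigD1 tt).
have otherE : \prod_(s | s != tt) mixed_factor t.+1 v w s =
    \prod_(s | s != tt) mixed_factor t v w s.
  apply: eq_bigr => s st; rewrite /mixed_factor ltnS leq_eqVlt.
  by rewrite (_ : (s == t :> nat) = false) //; apply: negbTE.
rewrite !split otherE -mulNr -mulrDl -mulNr -mulrDl /X.
rewrite {1}/mixed_factor /= ltnn {1}/mixed_factor /= ltnSn.
case: eqP => xt; last first.
  rewrite /slice_form /corner_form; case: (eqVneq (entry x0 w t).1 tt) => //= _.
  rewrite (_ : entry x0 w t == (tt, 0%R) = false) /= ?subrr ?mul0r //.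
  by apply: contra_notF xt => /eqP ->.
have [e0|e0] := eqVneq (euler_form v w) 0; first by rewrite e0 !mulr0.
congr (_ * _); rewrite /dbeta /beta.
have -> : \prod_(s | s != tt) mixed_factor t (v - step (entry x0 w t)) w s =
    \prod_(s | s != tt) mixed_factor t v w s.
  by apply: eq_bigr => s st; apply: mixed_factor_ext => i; rewrite step_other // xt eq_sym.
rewrite -mulrBr [RHS]mulrC.
have [r0|r0] := eqVneq (\prod_(s | s != tt) mixed_factor t v w s) 0.
  by rewrite r0 !mulr0.
congr (_ * _); rewrite homotopy_boundary // => v0 i.
apply: (euler_form_near wi _ e0) => s.
have [->//|st] := eqVneq s tt.
apply: (@mixed_factor_neq0 t _ w); apply: contraNneq r0 => r0.
by rewrite (bigD1 s) //= r0 mul0r.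
Qed.

(** The product of the slices is a cycle of the torus, and the Euler cocycle is a
    coboundary. *)
Lemma slice_product_eq0 :
  torus_pairing (fun v w => mixed_form D v w * euler_form v w) = 0.
Proof.
pose M := (Zp_trunc p + D' * q)%N.
pose pos i := (D + i)%N.
have pos_lt i : (i < M.+1)%N -> (pos i < n)%N.
  by move=> iN; rewrite card_directions ltn_add2l.
have pos_inj : {in gtn M.+1 &, injective pos} by move=> i j _ _ /addnI.
have form_swap (a b : nat) (v : V) (w : W) : (a < M.+1)%N -> (b < M.+1)%N ->
    mixed_form D v (swap_entries x0 (pos a) (pos b) w) = mixed_form D v w.
  move=> aN bN; apply: eq_bigr => s _; rewrite /mixed_factor.
  rewrite entry_swap ?pos_lt // /swap !ltn_eqF //.
    by rewrite (leq_trans (ltn_ord s)) ?leq_addr.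
  by rewrite (leq_trans (ltn_ord s)) ?leq_addr.
have St := @stokes F I n en x0 V step two_neq0 M pos (mixed_form D)
  (cup_primitive F lab D') pos_lt pos_inj form_swap (@local_cup_primitive F V _ lab D').
transitivity (torus_pairing (fun v w => mixed_form D v w * coboundary M.+1 (cup_primitive F lab D')
    (lattice_path step v (fun i => entry x0 w (pos i))))).
  apply: pairing_ext => v w _; congr (_ * _); exact/esym/cup_primitive_coboundary.
rewrite [LHS]St -[RHS](mul0r (torus_pairing (fun _ _ => 0))) -[RHS]pairingZ.
apply: pairing_ext => v w wi; rewrite mul0r.
suff -> : mixed_form D (v - step (entry x0 w (pos 0))) w = mixed_form D v w.
  by rewrite subrr mul0r.
apply: eq_bigr => s _; rewrite /mixed_factor ltn_ord /slice_form subr_step.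
rewrite (_ : entry x0 w s == entry x0 w (pos 0) = false) ?subr0 //.
apply/negbTE/eqP => /(entry_inj wi).
rewrite /pos addn0 => E.
have := ltn_ord s; rewrite [X in (X < _)%N -> _]E ?ltnn // ?pos_lt //.
  by rewrite card_directions (leq_trans (ltn_ord s)) ?leq_addr.
by rewrite card_directions addnC // -[X in (X < _)%N]add0n ltn_add2r.
Qed.

Definition turn_dir (x : I) : I := (x.1, x.2 + 1).
Definition turn (v : V) : V := [ffun x => v (x.1, x.2 - 1)].
Definition turn_dirs (w : W) : W := [ffun i => turn_dir (w i)].

Lemma turn_dir_inj : injective turn_dir.
Proof. move=> [a b] [c d] E; have := congr1 fst E; have := congr1 snd E => /= /addIr -> ->.
by []. Qed.

Lemma turn_turn_dir v x : turn v (turn_dir x) = v x.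
Proof. by case: x => s i; rewrite ffunE /= addrK. Qed.

Lemma iter_turn_dir x : iter p turn_dir x = x.
Proof.
have E m : iter m turn_dir x = (x.1, x.2 + m%:R).
  elim: m => [|m IH]; first by case: (x) => s i; rewrite /= addr0.
  by rewrite iterS IH /turn_dir /= -addrA natr1.
by rewrite E pchar_Zp ?prime_gt1 // addr0 -surjective_pairing.
Qed.

Lemma turn_inj : injective turn.
Proof.
by move=> v v' E; apply/ffunP => x; rewrite -turn_turn_dir E turn_turn_dir.
Qed.

Lemma turnD u v : turn (u + v) = turn u + turn v.
Proof. by apply/ffunP => x; rewrite !ffunE. Qed.

Lemma turn_step x : turn (step x) = step (turn_dir x).
Proof.
apply/ffunP => y; rewrite !ffunE -(inj_eq turn_dir_inj) /turn_dir /= subrK.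
by rewrite -surjective_pairing.
Qed.

Lemma turn_lattice_path v u i : lattice_path step (turn v) (turn_dir \o u) i = turn (lattice_path step v u i).
Proof.
rewrite /lattice_path; elim: i => [|i IH]; first by rewrite !big_ord0 !addr0.
by rewrite !big_ord_recr !addrA IH /= -turn_step -turnD.
Qed.

Lemma entry_turn (w : W) i : (i < n)%N -> entry x0 (turn_dirs w) i = turn_dir (entry x0 w i).
Proof. by move=> ilt; rewrite -[i]/(val (Ordinal ilt)) !entry_ord ffunE. Qed.

Lemma turn_dirs_inj : injective turn_dirs.
Proof.
by move=> w w' /ffunP E; apply/ffunP => i; have := E i; rewrite !ffunE => /turn_dir_inj.
Qed.

Lemma corner_form_turn s v x : corner_form F s (turn v) (turn_dir x) = corner_form F s v x.
Proof.
rewrite /corner_form turn_turn_dir; congr (_%:R); congr [&& _, _ & _] => /=.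
apply/forallP/forallP => H i; first by have := H (i + 1); rewrite ffunE /= addrK.
by rewrite ffunE.
Qed.

(** A simplex takes each direction at most once, so it stays in the unit cube at its
    base point. *)
Lemma lattice_path_coord v u i x : {in gtn i &, injective u} ->
  exists2 b : bool, lattice_path step v u i x = v x + b%:R & b -> exists2 j, (j < i)%N & u j = x.
Proof.
elim: i => [|i IH] ui.
  by exists false => //; rewrite /lattice_path big_ord0 !addr0.
have [|b E bP] := IH; first by move=> a c ai ci; apply: ui; rewrite inE ltnW.
have P : lattice_path step v u i.+1 x = v x + b%:R + (x == u i)%:R.
  by rewrite /lattice_path big_ord_recr addrA -/(lattice_path step v u i) ffunE E ffunE.
have [xu|xu] := eqVneq x (u i); last first.
  exists b; first by rewrite P (negbTE xu) addr0.
  by move=> /bP [j ji <-]; exists j => //; exact: ltnW.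
exists true; last by exists i.
rewrite P xu eqxx; case: b bP {E P} => [/(_ isT) [j ji uj]|_]; last by rewrite addr0.
by have := ui j i; rewrite !inE ltnS ltnW // ltnSn uj => /(_ isT isT xu) ji'; rewrite ji' ltnn in ji.
Qed.

Hypothesis lab_turn : forall a v, turn v != v -> lab a (turn v) = lab a v + 1.

(** The labels commute with the shift only off its fixed points, the diagonal.  A
    simplex of the product of cones meets the diagonal only at the apex: coordinate s
    of a fixed vertex is constant, and it is 0 at the normal direction of the s-th
    cone.  So a base point other than 0 is enough. *)
Lemma euler_form_turn v (w : W) : injective w -> mixed_form 0 v w != 0 -> v != 0 ->
  euler_form (turn v) (turn_dirs w) = euler_form v w.
Proof.
move=> wi form0 v0; rewrite /euler_form.
set u := fun i => entry x0 w (D + i).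
have -> : cup_form F lab D (lattice_path step (turn v) (fun i => entry x0 (turn_dirs w) (D + i))) =
          cup_form F lab D (turn \o lattice_path step v u).
  apply: local_cup_form => i iN; rewrite /= -turn_lattice_path; apply: lattice_path_eq => a ai.
  by rewrite entry_turn // card_directions ltn_add2l (leq_trans ai).
have corner (s : 'I_D) : (entry x0 w s).1 = s /\ v (entry x0 w s) = 0 /\ forall i, (v (s, i) < 2 * k)%N.
  have : mixed_factor 0 v w s != 0.
    by apply: contraNneq form0 => E; rewrite /mixed_form (bigD1 s) //= E mul0r.
  rewrite /mixed_factor /corner_form /=.
  case E: [&& _, _ & _]; last by rewrite mulr0n eqxx.
  by case/and3P: E => /eqP E1 /eqP E2 /forallP E3.
have u_inj i : (i <= D * q)%N -> {in gtn i &, injective u}.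
  move=> iN a b ai bi /(entry_inj wi) H; apply: (@addnI D); apply: H.
    by rewrite card_directions ltn_add2l (leq_trans ai).
  by rewrite card_directions ltn_add2l (leq_trans bi).
have moved i : (i <= D * q)%N -> turn (lattice_path step v u i) != lattice_path step v u i.
  move=> iN; apply/eqP => /ffunP fixed.
  have const s j : lattice_path step v u i (s, j) = lattice_path step v u i (s, 0).
    rewrite -[j]natr_Zp; elim: (nat_of_ord j) => [//|m IH].
    by rewrite -fixed ffunE /= mulrS addrAC subrr add0r.
  move/eqP: v0; apply; apply/ffunP => x; rewrite [RHS]ffunE.
  have [wx1 [vw0 vlt]] := corner x.1.
  have P0 : lattice_path step v u i (entry x0 w x.1) = 0.
    have [b E bP] := @lattice_path_coord v u i (entry x0 w x.1) (u_inj i iN).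
    rewrite E vw0; case: b bP {E} => [/(_ isT) [j ji /(entry_inj wi)]|]; last by rewrite addr0.
    have jn : (D + j < n)%N by rewrite card_directions ltn_add2l (leq_trans ji).
    have sn : (x.1 < n)%N by rewrite card_directions (leq_trans (ltn_ord x.1)) ?leq_addr.
    by move=> /(_ jn sn) H; have := ltn_ord x.1; rewrite -[X in (X < _)%N]H ltnNge leq_addr.
  have Px : lattice_path step v u i x = 0.
    move: P0; case: (x) wx1 => s j /= ws; case: (entry x0 w s) ws => s' j' /= ->.
    by rewrite !const.
  have [b E _] := @lattice_path_coord v u i x (u_inj i iN).
  move: Px; rewrite E; case: b {E} => [|]; last by rewrite addr0.
  have := vlt x.2; rewrite -surjective_pairing => vx /(congr1 (@nat_of_ord _)).
  rewrite Zm_valD1 //; case: ltnP => // /leq_trans /(_ vx).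
  by rewrite leq_pmul2r // (ltn_trans _ k3).
rewrite !cup_form_prod; apply: eq_bigr => a _; rewrite /block_form /degree_form.
rewrite -[RHS](@orient_comp _ _ _ _ id _ _ (fun i => i + 1) p) //; last 2 first.
- exact: addIr.
- move=> y; have E m : iter m (fun i : 'Z_p => i + 1) y = y + m%:R.
    by elim: m => [|m IH]; rewrite ?addr0 // iterS IH -addrA natr1.
  by rewrite E pchar_Zp ?prime_gt1 // addr0.
apply: orient_ext => i iq /=; rewrite lab_turn // moved //.
rewrite -ltnS (leq_trans (n := a * q + q.+1)%N) // ?ltn_add2l //.
rewrite addnS ltnS -mulSnr leq_mul2r ltn_ord orbT //.
Qed.

Lemma mixed_form_turn v w : mixed_form 0 (turn v) (turn_dirs w) = mixed_form 0 v w.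
Proof.
rewrite /mixed_form; apply: eq_bigr => s _.
rewrite /mixed_factor /= entry_turn ?corner_form_turn //.
by rewrite card_directions (leq_trans (ltn_ord s)) ?leq_addr.
Qed.

(** Group the simplices by the second component of the normal direction of the first
    cone.  The shift permutes the p groups cyclically and preserves their sums, so
    the total is p times one of them. *)
Lemma off_center_eq0 :
  torus_pairing (fun v w => (v != 0)%:R * (mixed_form 0 v w * euler_form v w)) = 0.
Proof.
pose Y g v w : F := ((entry x0 w 0).2 == g)%:R * ((v != 0)%:R * (mixed_form 0 v w * euler_form v w)).
transitivity (\sum_g torus_pairing (Y g)).
  rewrite -[RHS]pairing_sum; apply: pairing_ext => v w _.
  rewrite -mulr_suml (bigD1 (entry x0 w 0).2) //= eqxx big1 ?addr0 ?mul1r // => g.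
  by rewrite eq_sym => /negbTE ->.
have n0 : (0 < n)%N by rewrite card_directions.
have Ystep g : torus_pairing (Y (g + 1)) = torus_pairing (Y g).
  rewrite /torus_pairing (pairing_reindex _ turn_dirs_inj turn_inj) => [|w]; last first.
    rewrite -[RHS](orient_comp F enK rkK turn_dir_inj p_odd iter_turn_dir).
    by apply: orient_ext => i ilt; rewrite entry_turn.
  apply: pairing_ext => v w wi.
  have gE : ((entry x0 w 0).2 + 1 == g + 1) = ((entry x0 w 0).2 == g).
    by apply/eqP/eqP => [|-> //]; apply: addIr.
  have rot0 : turn 0 = 0 by apply/ffunP => x; rewrite !ffunE.
  have vE : (turn v == 0) = (v == 0).
    by apply/eqP/eqP => [|->//]; rewrite -{1}rot0; apply: turn_inj.
  have := @euler_form_turn v w wi; rewrite /Y (entry_turn w n0) [(turn_dir _).2]/= gE vE mixed_form_turn.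
  move: (euler_form (turn v) _) (euler_form v w) (mixed_form 0 v w) => e1 e2 f e12.
  case: (v == 0) e12 => [_|/(_ _ isT) e12]; first by rewrite !mul0r !mulr0.
  by have [->|/e12 ->] := eqVneq f 0; rewrite ?mul0r.
have Yconst g : torus_pairing (Y g) = torus_pairing (Y 0).
  rewrite -[g]natr_Zp; elim: (nat_of_ord g) => [//|m IH].
  by rewrite mulrSr Ystep.
rewrite (eq_bigr (fun=> torus_pairing (Y 0))) // sumr_const card_ord -mulr_natl Zp_card p_natr_eq0.
by rewrite mul0r.
Qed.

Lemma center_eq0 :
  \sum_(w : W) orient F en (entry x0 w) * (mixed_form 0 0 w * euler_form 0 w) = 0.
Proof.
have all t : (t <= D)%N -> torus_pairing (fun v w => mixed_form 0 v w * euler_form v w) =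
    torus_pairing (fun v w => mixed_form t v w * euler_form v w).
  elim: t => [//|t IH] tD; rewrite (IH (ltnW tD)); exact: mixed_step.
have := slice_product_eq0; rewrite -all //.
transitivity (torus_pairing (fun v w => (v == 0)%:R * (mixed_form 0 v w * euler_form v w) +
    (v != 0)%:R * (mixed_form 0 v w * euler_form v w))); last first.
  rewrite -[RHS]slice_product_eq0 -all //; apply: pairing_ext => v w _.
  by case: (v == 0); rewrite /= ?mul1r ?mul0r ?addr0 ?add0r.
rewrite /torus_pairing pairingD -/torus_pairing off_center_eq0 addr0 /torus_pairing /pairing; apply: eq_bigr => w _.
rewrite (bigD1 0) //= eqxx mul1r big1 ?addr0 // => v /negbTE ->.
by rewrite mul0r mulr0.
Qed.

End TorusPairing.

(** * Flags of sets and the labels along them *)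

Lemma leq_of_sub n a b : (a <= n -> n - b <= n - a -> a <= b)%N.
Proof. lia. Qed.

Section PeelOrder.
Local Open Scope nat_scope.
Variables (Z : finType) (nu : {set Z} -> Z).
Hypothesis nu_in : forall B : {set Z}, B != set0 -> nu B \in B.

(** The order in which the elements of B must be inserted if the label nu of every
    initial part is to be its newest element. *)
Fixpoint peel m (B : {set Z}) : seq Z :=
  if m is m'.+1 then rcons (peel m' (B :\ nu B)) (nu B) else [::].

Definition peeled (b : seq Z) :=
  forall z i, (i < size b)%N -> nu [set x in take i.+1 b] = nth z b i.

Lemma peeled_rcons b x : peeled (rcons b x) <-> peeled b /\ nu [set y in rcons b x] = x.
Proof.
split=> [H|[H1 H2]].
  split=> [z i ib|].
    have := H z i; rewrite size_rcons ltnS (ltnW ib) => /(_ isT).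
    by rewrite nth_rcons ib -cats1 takel_cat.
  have := H x (size b); rewrite size_rcons ltnSn => /(_ isT).
  by rewrite nth_rcons ltnn eqxx take_oversize // size_rcons.
move=> z i; rewrite size_rcons ltnS leq_eqVlt => /orP[/eqP->|ib].
  by rewrite nth_rcons ltnn eqxx take_oversize ?size_rcons.
by rewrite nth_rcons ib -cats1 takel_cat // (H1 z).
Qed.

Lemma peelP m (B : {set Z}) : #|B| = m ->
  [/\ size (peel m B) = m, uniq (peel m B), [set x in peel m B] = B & peeled (peel m B)].
Proof.
elim: m B => [|m IH] B cB /=.
  by split=> //; move/eqP: cB; rewrite cards_eq0 => /eqP ->; apply/setP => x; rewrite !inE.
have B0 : B != set0 by rewrite -cards_eq0 cB.
have cB' : #|B :\ nu B| = m.
  by apply/eqP; rewrite -eqSS -cB (cardsD1 (nu B) B) nu_in.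
have [s1 u1 e1 p1] := IH _ cB'.
have eB : [set x in rcons (peel m (B :\ nu B)) (nu B)] = B.
  apply/setP => x; rewrite inE mem_rcons inE -[x \in peel _ _]inE e1 !inE.
  by case: eqP => //= ->; rewrite nu_in.
split; rewrite ?size_rcons ?s1 //.
  by rewrite rcons_uniq u1 andbT -[_ \in peel _ _]inE e1 !inE eqxx.
by rewrite peeled_rcons; split=> //; rewrite eB.
Qed.

Lemma peeled_unique b c : uniq b -> uniq c -> [set x in b] = [set x in c] ->
  peeled b -> peeled c -> b = c.
Proof.
elim/last_ind: b c => [|b x IH] c.
  move=> _ _ E _ _; case: c E => // y c /setP /(_ y).
  by rewrite !inE eqxx.
case/lastP: c => [|c y].
  by move=> _ _ /setP /(_ x); rewrite !inE mem_rcons inE eqxx.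
rewrite !rcons_uniq => /andP[xb ub] /andP[yc uc] E /peeled_rcons[pb nb] /peeled_rcons[pc nc].
have xy : x = y by rewrite -nb -nc E.
rewrite xy (IH c) // ; apply/setP => z; move/setP: E => /(_ z).
rewrite !inE !mem_rcons !inE -xy; case: (eqVneq z x) => //= ->.
by rewrite (negbTE xb) xy (negbTE yc).
Qed.

End PeelOrder.

Section Flags.
Local Open Scope nat_scope.
Variables (D q : nat) (Z : finType) (nu : {set Z} -> Z).
Hypothesis nu_in : forall B : {set Z}, B != set0 -> nu B \in B.
Hypothesis card_Z : #|Z| = q.+1.
Local Notation I := ('I_D * Z)%type.

Definition slice (B : {set I}) (s : 'I_D) : {set Z} := [set i | (s, i) \in B].

(** The last nonempty slice.  Labels at the apex depend on this slice only, so
    inserting an element in a lower slice repeats a label. *)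
Definition top_slice (B : {set I}) : {set Z} :=
  if [pick s | (slice B s != set0) && [forall s' : 'I_D, (s < s')%N ==> (slice B s' == set0)]]
    is Some s then slice B s else set0.

Lemma top_sliceE (B : {set I}) (s : 'I_D) : slice B s != set0 -> (forall s' : 'I_D, (s < s')%N -> slice B s' = set0) ->
  top_slice B = slice B s.
Proof.
move=> Bs above; rewrite /top_slice; case: pickP => [t /andP[Bt /forallP topt]|/(_ s)].
  suff -> : t = s by [].
  apply: ord_inj; apply/eqP; rewrite eqn_leq; apply/andP; split; rewrite leqNgt.
    by apply: contra Bt => /above ->.
  by have := topt s; case: ltnP => //= _; rewrite (negbTE Bs).
rewrite Bs /= => /negbT; rewrite negb_forall => /existsP[s'].
by rewrite negb_imply => /andP[/above ->]; rewrite eqxx.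
Qed.

Lemma top_slice0 : top_slice set0 = set0.
Proof.
rewrite /top_slice; case: pickP => [s|//]; rewrite (_ : slice set0 s = set0) ?eqxx //.
by apply/setP => i; rewrite !inE.
Qed.

Lemma top_slice_exists (B : {set I}) (x : I) : x \in B -> exists s : 'I_D,
  [/\ (x.1 <= s)%N, top_slice B = slice B s, slice B s != set0 &
      forall s' : 'I_D, (s < s')%N -> slice B s' = set0].
Proof.
move=> xB; have Bx : slice B x.1 != set0.
  by apply/set0Pn; exists x.2; rewrite inE -surjective_pairing.
pose s := [arg max_(s > x.1 | slice B s != set0) (s : nat)].
have [Bs le_s] : slice B s != set0 /\ forall s' : 'I_D, slice B s' != set0 -> (s' <= s)%N.
  by rewrite /s; case: arg_maxnP.
have above (s' : 'I_D) : (s < s')%N -> slice B s' = set0.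
  by move=> ss'; apply/eqP; apply: contraLR ss' => /le_s; rewrite leqNgt.
by exists s; split=> //; [exact: le_s | exact: top_sliceE].
Qed.

Definition prefix_set (u : nat -> I) m : {set I} := [set x in [seq u j | j <- iota 0 m]].

Lemma prefix_setP u m x : reflect (exists2 j, (j < m)%N & u j = x) (x \in prefix_set u m).
Proof.
rewrite inE; apply: (iffP mapP) => [[j]|[j jm <-]].
  by rewrite mem_iota => jm ->; exists j.
by exists j; rewrite ?mem_iota.
Qed.

Lemma prefix_set0 u : prefix_set u 0 = set0.
Proof. by apply/setP => x; rewrite !inE. Qed.

Definition top_label u m := nu (top_slice (prefix_set u m)).

Lemma top_slice_block (u : nat -> I) (a : 'I_D) i : (0 < i <= q)%N ->
  (forall j, (j < D * q)%N -> (u j).1 = j %/ q :> nat) ->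
  top_slice (prefix_set u (a * q + i)) = [set x in mkseq (fun j => (u (a * q + j)%N).2) i].
Proof.
move=> /andP[i0 iq] ub.
have aqD : (a * q + q <= D * q)%N by rewrite -mulSnr leq_mul2r ltn_ord orbT.
have q0 : (0 < q)%N by exact: leq_trans i0 iq.
have lt_D j : (j < a * q + i)%N -> (j < D * q)%N.
  by move=> ji; apply: leq_trans ji (leq_trans _ aqD); rewrite leq_add2l.
have -> : [set x in mkseq (fun j => (u (a * q + j)%N).2) i] = slice (prefix_set u (a * q + i)) a.
  apply/setP => x; rewrite inE [RHS]inE; apply/mapP/prefix_setP => [[j]|[j ji uj]].
    rewrite mem_iota add0n => /= ji ->; exists (a * q + j)%N; first by rewrite ltn_add2l.
    rewrite [LHS]surjective_pairing; congr pair; apply: val_inj.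
    by rewrite /= ub ?lt_D ?ltn_add2l // divnMDl // divn_small ?addn0 // (leq_trans ji).
  have := ub j (lt_D j ji); rewrite uj /= => aE.
  have ja : (a * q <= j)%N by rewrite aE leq_trunc_div.
  exists (j - a * q)%N; last by rewrite subnKC // uj.
  by rewrite mem_iota add0n ltn_subLR.
apply: top_sliceE => [|s' as']; last first.
  apply/setP => x; rewrite !inE; apply/negbTE; apply/negP => /mapP[j].
  rewrite mem_iota => /andP[_ ji] /(congr1 fst) /(congr1 (@nat_of_ord D)) /=.
  rewrite ub ?lt_D // => s'E; have : (a.+1 * q <= j)%N by rewrite -leq_divRL // -s'E.
  rewrite mulSnr => le; have := leq_ltn_trans le ji.
  by rewrite ltn_add2l ltnNge iq.
apply/set0Pn; exists (u (a * q)%N).2; rewrite inE; apply/prefix_setP; exists (a * q)%N.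
  by rewrite -[X in (X < _)%N]addn0 ltn_add2l.
rewrite [LHS]surjective_pairing; congr pair; apply: val_inj.
by rewrite /= ub ?mulnK // (leq_trans _ aqD) // -[X in (X < _)%N]addn0 ltn_add2l.
Qed.

(** Along the contributing flag the direction omitted in block a is the label reached
    at the end of block a - 1, since the labels met in block a start with it and are
    all distinct. *)
Definition omitted a : Z := iter a (fun z => nu (~: [set z])) (nu set0).

Definition block_order a : seq Z := peel nu q (~: [set omitted a]).

Lemma card_compl (z : Z) : #|~: [set z]| = q.
Proof. by have := cardsC1 z; rewrite card_Z. Qed.

Section Necessity.
Variables (u : nat -> I) (g : 'I_D -> Z).
Hypothesis u_inj : {in gtn (D * q) &, injective u}.
Hypothesis u_avoids : forall j s, (j < D * q)%N -> u j != (s, g s).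
Hypothesis u_covers : forall x, x = (x.1, g x.1) \/ exists2 j, (j < D * q)%N & u j = x.
Hypothesis windows : forall a : 'I_D,
  {in gtn q.+1 &, injective (fun i => top_label u (a * q + i))}.

(** An insertion below the top slice would leave the label unchanged, and two
    consecutive vertices always lie in a common window. *)
Lemma block_mono j m : (j < m)%N -> (m < D * q)%N -> ((u j).1 <= (u m).1)%N.
Proof.
move=> jm mN; rewrite leqNgt; apply/negP => lt.
have q0 : (0 < q)%N by case: (q) mN; rewrite ?muln0.
have ujB : u j \in prefix_set u m by apply/prefix_setP; exists j.
have [s [us topE sB above]] := top_slice_exists ujB.
have mem_next x : (x \in prefix_set u m.+1) = (x \in prefix_set u m) || (x == u m).
  apply/prefix_setP/orP => [[i]|[/prefix_setP[i im <-]|/eqP->]].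
  - rewrite ltnS leq_eqVlt => /orP[/eqP->|im] <-; first by right.
    by left; apply/prefix_setP; exists i.
  - by exists i => //; exact: ltnW.
  - by exists m.
have slice_next (s' : 'I_D) : s' != (u m).1 -> slice (prefix_set u m.+1) s' = slice (prefix_set u m) s'.
  move=> s'm; apply/setP => i; rewrite ![_ \in slice _ _]inE mem_next.
  by rewrite (_ : (s', i) == u m = false) ?orbF //; apply: contraNF s'm => /eqP <-.
have ltms : ((u m).1 < s)%N by exact: leq_trans lt us.
have neq (s' : 'I_D) : (s <= s')%N -> s' != (u m).1.
  by move=> ss'; rewrite -val_eqE /= gtn_eqF // (leq_trans ltms).
have same : top_slice (prefix_set u m.+1) = top_slice (prefix_set u m).
  rewrite topE -slice_next ?neq //; apply: top_sliceE; first by rewrite slice_next ?neq.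
  by move=> s' ss'; rewrite slice_next ?neq ?above // ltnW.
have aD : (m %/ q < D)%N by rewrite ltn_divLR.
have := @windows (Ordinal aD) (m %% q) (m %% q).+1; rewrite !inE /= !ltnS.
have mq : (m %% q < q)%N by rewrite ltn_pmod.
rewrite mq (ltnW mq) addnS -divn_eq /top_label same => /(_ isT isT erefl).
by move/eqP; rewrite ltn_eqF.
Qed.

(** Numbers the elements that are inserted, block by block. *)
Let code (x : I) := (x.1 * q + index x.2 (enum (~: [set g x.1])))%N.

Let code_lt x : x.2 != g x.1 -> (x.1 * q <= code x < x.1.+1 * q)%N.
Proof.
move=> xg; rewrite leq_addr mulSnr ltn_add2l -(card_compl (g x.1)) cardE index_mem.
by rewrite mem_enum !inE.
Qed.

Let u_code j : (j < D * q)%N -> (u j).2 != g (u j).1.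
Proof.
by move=> jN; apply: contra (u_avoids (u j).1 jN) => /eqP <-; rewrite -surjective_pairing.
Qed.

Let code_inj x y : x.2 != g x.1 -> y.2 != g y.1 -> code x = code y -> x = y.
Proof.
move=> xg yg E.
have s : x.1 = y.1.
  have /andP[x1 x2] := code_lt xg; have /andP[y1 y2] := code_lt yg.
  apply: ord_inj; apply/eqP; rewrite eqn_leq -ltnS -[X in _ && X]ltnS.
  have q0 : (0 < q)%N by case: (q) (leq_ltn_trans x1 x2); rewrite ?muln0.
  rewrite -![(_ < _.+1)%N](ltn_pmul2r q0) (leq_ltn_trans x1) ?E //=.
  by rewrite (leq_ltn_trans y1) // -E.
move: E; rewrite /code s => /addnI E.
have : x.2 = y.2.
  have xin : x.2 \in enum (~: [set g y.1]) by rewrite mem_enum !inE -s.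
  have yin : y.2 \in enum (~: [set g y.1]) by rewrite mem_enum !inE.
  by rewrite -(nth_index x.2 xin) E nth_index.
by case: x y s {xg yg E} => x1 x2 [y1 y2] /= -> ->.
Qed.

(** Blocks are visited in increasing order and each receives q elements, so the block
    of the m-th insertion is m %/ q.  Both inequalities count with [code]: the first
    m + 1 insertions lie in blocks up to that of u m, the others in blocks from it on. *)
Lemma block_of m : (m < D * q)%N -> (u m).1 = m %/ q :> nat.
Proof.
move=> mN; have q0 : (0 < q)%N by case: (q) mN; rewrite ?muln0.
have uniq_codes a b : (a + b <= D * q)%N -> uniq [seq code (u j) | j <- iota a b].
  move=> ab; rewrite map_inj_in_uniq ?iota_uniq // => i j; rewrite !mem_iota.
  move=> /andP[_ ib] /andP[_ jb] /code_inj H.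
  have iN := leq_trans ib ab; have jN := leq_trans jb ab.
  by apply: u_inj => //; apply: H; exact: u_code.
apply/eqP; rewrite eqn_leq; apply/andP; split.
  rewrite leq_divRL //; apply: (@leq_of_sub (D * q)).
    by rewrite leq_mul2r ltnW ?orbT.
  have := @uniq_leq_size _ [seq code (u j) | j <- iota m (D * q - m)]
    (iota ((u m).1 * q) (D * q - (u m).1 * q)).
  rewrite size_map !size_iota; apply; first by apply: uniq_codes; rewrite subnKC // ltnW.
  move=> c /mapP[j]; rewrite !mem_iota subnKC ?(ltnW mN) // => /andP[mj jN] ->.
  rewrite subnKC; last by rewrite leq_mul2r ltnW ?orbT.
  have /andP[c1 c2] := code_lt (u_code jN).
  have mono : ((u m).1 <= (u j).1)%N.
    by move: mj; rewrite leq_eqVlt => /orP[/eqP<-//|mj]; exact: block_mono.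
  rewrite (leq_trans _ c1) ?leq_mul2r ?mono ?orbT //=.
  by rewrite (leq_trans c2) // leq_mul2r ltn_ord orbT.
rewrite -ltnS ltn_divLR //.
have := @uniq_leq_size _ [seq code (u j) | j <- iota 0 m.+1] (iota 0 ((u m).1.+1 * q)).
rewrite size_map !size_iota; apply; first exact: uniq_codes.
move=> c /mapP[j]; rewrite !mem_iota !add0n /= ltnS => jm ->.
have /andP[c1 c2] := code_lt (u_code (leq_ltn_trans jm mN)).
rewrite (leq_trans c2) // leq_mul2r ltnS.
by move: jm; rewrite leq_eqVlt => /orP[/eqP->|jm]; rewrite ?leqnn ?block_mono ?orbT.
Qed.

(** Within block a the label of each partial slice belongs to that slice and differs
    from the earlier labels, which are the earlier elements; so it is the newest
    element.  The initial label of the window is different from all of these, so it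
    is the element that block a omits. *)
Lemma block_unique (a : 'I_D) : g a = top_label u (a * q) /\
  mkseq (fun j => (u (a * q + j)%N).2) q = peel nu q (~: [set top_label u (a * q)]).
Proof.
set l0 := top_label u (a * q); set b := mkseq _ q.
have aqD : (a * q + q <= D * q)%N by rewrite -mulSnr leq_mul2r ltn_ord orbT.
have lt_D j : (j < q)%N -> (a * q + j < D * q)%N.
  by move=> jq; apply: leq_trans aqD; rewrite ltn_add2l.
have sb : size b = q by rewrite size_mkseq.
have blockE j : (j < q)%N -> (u (a * q + j)%N).1 = a.
  move=> jq; apply: val_inj; rewrite /= block_of ?lt_D //.
  by rewrite divnMDl ?divn_small ?addn0 // (leq_ltn_trans _ jq).
have nthb z j : (j < q)%N -> nth z b j = (u (a * q + j)%N).2 by move=> jq; rewrite nth_mkseq.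
have ub : uniq b.
  apply/mkseq_uniqP => i j; rewrite !inE => iq jq ij.
  apply: (@addnI (a * q)); apply: u_inj; rewrite ?inE ?lt_D //.
  by rewrite [LHS]surjective_pairing [RHS]surjective_pairing !blockE // ij.
have labelE i : (i < q)%N -> top_label u (a * q + i.+1) = nu [set x in take i.+1 b].
  move=> iq; rewrite /top_label top_slice_block ?iq //; last exact: block_of.
  by rewrite /b /mkseq -map_take take_iota (minn_idPl iq).
have window i j : (i <= q)%N -> (j <= q)%N ->
    top_label u (a * q + i) = top_label u (a * q + j) -> i = j.
  by move=> iq jq; apply: windows; rewrite inE ltnS.
have pb : peeled nu b.
  move=> z i; rewrite sb; elim/ltn_ind: i => i IH iq.
  have : nu [set x in take i.+1 b] \in [set x in take i.+1 b].
    apply: nu_in; apply/set0Pn; exists (nth z b 0); rewrite inE.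
    by rewrite -(nth_take z (ltn0Sn i)) mem_nth // size_takel ?sb.
  rewrite inE => /(nthP z)[j]; rewrite size_takel ?sb // ltnS => ji.
  rewrite nth_take ?ltnS // => jE; move: ji; rewrite leq_eqVlt => /orP[/eqP ij|ji]; first by rewrite -jE ij.
  have jq := ltn_trans ji iq.
  have := window j.+1 i.+1 jq iq; rewrite !labelE // (IH j) // jE => /(_ erefl) [] E.
  by rewrite E ltnn in ji.
have l0b i : (i < q)%N -> l0 <> (u (a * q + i)%N).2.
  move=> iq l0E; have := window 0 i.+1 (leq0n _) iq.
  by rewrite addn0 -/l0 labelE // (pb l0) ?sb // nthb // => /(_ l0E).
have covers x : x = g a \/ exists2 i, (i < q)%N & x = (u (a * q + i)%N).2.
  have [[->]|[j jN uj]] := u_covers (a, x); [by left|right].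
  have := block_of jN; rewrite uj /= => aE.
  have q0 : (0 < q)%N by case: (q) jN; rewrite ?muln0.
  by exists (j %% q); rewrite ?ltn_pmod // aE -divn_eq uj.
have ga : g a = l0.
  by have [->//|[i iq]] := covers l0; move/(l0b i iq).
split=> //; have [s1 u1 e1 p1] := peelP nu_in (card_compl l0).
apply: (@peeled_unique _ nu) => //; rewrite e1; apply/setP => x; rewrite !inE.
apply/idP/idP => [/(nthP x)[i]|xl0].
  by rewrite sb => iq; rewrite nthb // => <-; apply/eqP => /esym/(l0b i iq).
have [xg|[i iq ->]] := covers x; first by rewrite xg ga eqxx in xl0.
by rewrite -(nthb x) // mem_nth ?sb.
Qed.

Lemma top_label_start (a : nat) : (a < D)%N -> top_label u (a * q) = omitted a.
Proof.
elim: a => [|a IH] aD.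
  by rewrite mul0n /top_label prefix_set0 top_slice0.
pose a' := Ordinal (ltnW aD); have [ga bE] := block_unique a'.
have [q0|q0] := posnP q.
  have z : forall z : Z, ~: [set z] = set0.
    by move=> z; apply/eqP; rewrite -cards_eq0 card_compl q0.
  have -> : omitted a.+1 = nu set0 by rewrite /omitted iterS z.
  by rewrite /top_label q0 muln0 prefix_set0 top_slice0.
rewrite mulSnr /top_label (@top_slice_block u a') ?leqnn ?q0 //; last exact: block_of.
rewrite bE /= IH ?(ltnW aD) //.
by have [_ _ -> _] := peelP nu_in (card_compl (omitted a)).
Qed.

Lemma flag_unique (a : 'I_D) : g a = omitted a /\
  mkseq (fun j => (u (a * q + j)%N).2) q = block_order a.
Proof. by have := block_unique a; rewrite top_label_start. Qed.

End Necessity.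

Section Existence.
Variable z0 : Z.

Variable u : nat -> I.
Hypothesis uE : forall (a : 'I_D) i, (i < q)%N -> u (a * q + i) = (a, nth z0 (block_order a) i).

Lemma flag_decomp m : (m < D * q)%N -> exists a : 'I_D, exists2 i, (i < q)%N & m = (a * q + i)%N.
Proof.
move=> mN; have q0 : (0 < q)%N by case: (q) mN; rewrite ?muln0.
have aD : (m %/ q < D)%N by rewrite ltn_divLR.
by exists (Ordinal aD), (m %% q); rewrite ?ltn_pmod //= -divn_eq.
Qed.

Lemma flag_inj : {in gtn (D * q) &, injective u}.
Proof.
move=> m m'; rewrite !inE => /flag_decomp[a [i iq ->]] /flag_decomp[b [j jq ->]].
rewrite !uE // => -[<-] E.
have [s1 u1 _ _] := peelP nu_in (card_compl (omitted a)).
move/eqP: E; rewrite nth_uniq -/(block_order a) ?/block_order ?s1 // => /eqP ->.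
by [].
Qed.

Lemma flag_avoids m (s : 'I_D) : (m < D * q)%N -> u m != (s, omitted s).
Proof.
move=> /flag_decomp[a [i iq ->]]; rewrite uE // xpair_eqE; apply/nandP.
have [<-|/eqP as_] := eqVneq a s; [right|by left; apply/eqP].
have [s1 _ e1 _] := peelP nu_in (card_compl (omitted a)).
have : nth z0 (block_order a) i \in [set x in block_order a] by rewrite inE mem_nth // s1.
by rewrite e1 !inE.
Qed.

(** The labels in window a are [omitted a] followed by the elements of the block. *)
Lemma flag_windows (a : 'I_D) :
  {in gtn q.+1 &, injective (fun i => top_label u (a * q + i))}.
Proof.
have ub j : (j < D * q)%N -> (u j).1 = j %/ q :> nat.
  move=> /flag_decomp[b [i iq ->]]; rewrite uE //=.
  by rewrite divnMDl ?divn_small ?addn0 // (leq_ltn_trans _ iq).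
have blockE (b : 'I_D) i : (i <= q)%N ->
    mkseq (fun j => (u (b * q + j)%N).2) i = take i (block_order b).
  move=> iq; have [s1 _ _ _] := peelP nu_in (card_compl (omitted b)).
  apply: (@eq_from_nth _ z0) => [|j]; rewrite size_mkseq ?size_takel ?s1 // => ji.
  by rewrite nth_mkseq // nth_take // uE ?(leq_trans ji).
have [s1 u1 e1 p1] := peelP nu_in (card_compl (omitted a)).
have start : top_label u (a * q) = omitted a.
  case: a {s1 u1 e1 p1} => -[|a] aD /=.
    by rewrite mul0n /top_label prefix_set0 top_slice0.
  have [q0|q0] := posnP q.
    have z : forall z : Z, ~: [set z] = set0.
      by move=> z; apply/eqP; rewrite -cards_eq0 card_compl q0.
    rewrite /omitted /= z.
    by rewrite /top_label q0 muln0 prefix_set0 top_slice0.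
  rewrite mulSnr /top_label (@top_slice_block u (Ordinal (ltnW aD))) ?leqnn ?q0 //.
  rewrite blockE //; have [s1 _ e1 _] := peelP nu_in (card_compl (omitted a)).
  by rewrite take_oversize ?s1 // e1.
have labelE i : (i < q.+1)%N -> top_label u (a * q + i) = nth z0 (omitted a :: block_order a) i.
  case: i => [|i] iq; first by rewrite addn0 start.
  by rewrite /top_label (@top_slice_block u a i.+1 iq ub) blockE //= (p1 z0) // s1.
have uo : uniq (omitted a :: block_order a).
  by rewrite /= u1 andbT -[_ \in _]inE e1 !inE eqxx.
move=> i j; rewrite !inE => iq jq; rewrite !labelE // => /eqP.
by rewrite nth_uniq //= ?s1 // => /eqP.
Qed.

End Existence.
End Flags.

(** * The apex of the cone contributes a unit *)

Section CenterTerm.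
Variables (p D' k : nat).
Hypotheses (p_prime : prime p) (k3 : (2 < k)%N).

Local Opaque entry swap_entries.

Local Notation D := D'.+1.
Local Notation I := ('I_D'.+1 * 'Z_p)%type.
Local Notation V := {ffun 'I_D'.+1 * 'Z_p -> 'Z_(8 * k)}.
Local Notation F := 'F_p.
Local Notation n := #|{: 'I_D'.+1 * 'Z_p}|.
Local Notation W := {ffun 'I_#|{: 'I_D'.+1 * 'Z_p}| -> 'I_D'.+1 * 'Z_p}.
Local Notation q := (Zp_trunc p).+1.
Local Notation step := (@unit_step p D'.+1 k).

Let x0 : I := (ord0, 0).
Let en (i : 'I_n) : I := enum_val i.
Let rk (x : I) : 'I_n := enum_rank x.
Let enK : cancel en rk. Proof. exact: enum_valK. Qed.
Let rkK : cancel rk en. Proof. exact: enum_rankK. Qed.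

Variable lab : nat -> V -> 'Z_p.
Variable nu : {set 'Z_p} -> 'Z_p.
Hypothesis nu_in : forall B : {set 'Z_p}, B != set0 -> nu B \in B.

Definition vertex_of (B : {set I}) : V := [ffun x => (x \in B)%:R].

(* Prescribed labels on the vertices of the unit cube at the apex. *)
Hypothesis lab_center : forall a (B : {set I}), (forall s, exists i, (s, i) \notin B) ->
  lab a (vertex_of B) = nu (top_slice B).

Lemma lattice_path_center (u : nat -> I) m : {in gtn m &, injective u} ->
  lattice_path step 0 u m = vertex_of (prefix_set u m).
Proof.
elim: m => [|m IH] ui.
  by rewrite prefix_set0 /lattice_path big_ord0 addr0; apply/ffunP => x; rewrite !ffunE inE.
rewrite /lattice_path big_ord_recr addrA -/(lattice_path step 0 u m) IH; last first.
  by move=> a c am cm; apply: ui; rewrite inE ltnW.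
apply/ffunP => x; rewrite !ffunE.
have um : u m \notin prefix_set u m.
  apply/negP => /prefix_setP[j jm uj]; have := ui j m; rewrite !inE ltnS ltnW // ltnSn uj.
  by move=> /(_ isT isT erefl) jE; rewrite jE ltnn in jm.
have -> : (x \in prefix_set u m.+1) = (x \in prefix_set u m) || (x == u m).
  apply/prefix_setP/orP => [[i]|[/prefix_setP[i im <-]|/eqP->]].
  - rewrite ltnS leq_eqVlt => /orP[/eqP->|im] <-; first by right.
    by left; apply/prefix_setP; exists i.
  - by exists i => //; exact: ltnW.
  - by exists m.
by have [->|_] := eqVneq x (u m); rewrite ?(negbTE um) ?orbF ?addr0 //= add0r.
Qed.

Let dirs (w : W) := fun i => entry x0 w (D + i).

Let dirs_inj (w : W) : injective w -> {in gtn (D * q) &, injective (dirs w)}.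
Proof.
move=> wi a b aN bN /(entry_inj wi) E; apply: (@addnI D); apply: E;
  by rewrite card_directions ltn_add2l.
Qed.

Let dirs_avoid (w : W) : injective w -> (forall s : 'I_D, (entry x0 w s).1 = s) ->
  forall j (s : 'I_D), (j < D * q)%N -> dirs w j != (s, (entry x0 w s).2).
Proof.
move=> wi w1 j s jN; rewrite -{1}(w1 s) -surjective_pairing.
apply/eqP => /(entry_inj wi) E.
have jn : (D + j < n)%N by rewrite card_directions ltn_add2l.
have sn : (s < n)%N by rewrite card_directions (leq_trans (ltn_ord s)) ?leq_addr.
by have := ltn_ord s; rewrite -(E jn sn) ltnNge leq_addr.
Qed.

Lemma euler_form_center (w : W) : injective w -> (forall s : 'I_D, (entry x0 w s).1 = s) ->
  euler_form lab (0 : V) w = \prod_(a < D) degree_form F (fun i => top_label nu (dirs w) (a * q + i)).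
Proof.
move=> wi w1; rewrite /euler_form cup_form_prod; apply: eq_bigr => a _.
apply: orient_ext => i iq /=.
have iN : (a * q + i <= D * q)%N.
  rewrite -ltnS (leq_trans (n := a * q + q.+1)%N) // ?ltn_add2l //.
  by rewrite addnS ltnS -mulSnr leq_mul2r ltn_ord orbT.
rewrite /shift lattice_path_center; last first.
  by move=> b c bi ci; apply: (dirs_inj wi); rewrite inE (leq_trans _ iN).
rewrite lab_center // => s; exists (entry x0 w s).2.
apply/negP => /prefix_setP[j ji]; apply/eqP; apply: dirs_avoid => //.
by rewrite (leq_trans ji).
Qed.

Lemma mixed_center (w : W) : mixed_form 0 (0 : V) w = [forall s : 'I_D, (entry x0 w s).1 == s]%:R :> F.
Proof.
have E (s : 'I_D) : mixed_factor 0 (0 : V) w s = ((entry x0 w s).1 == s)%:R.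
  rewrite /mixed_factor /corner_form /= ffunE eqxx /=.
  have -> : [forall i, ((0%R : V) (s, i) < 2 * k)%N].
    by apply/forallP => i; rewrite ffunE muln_gt0 /= (ltn_trans _ k3).
  by rewrite andbT.
rewrite /mixed_form; case: forallP => [H|H]; first by rewrite big1 // => s _; rewrite E H.
have [s ws] : exists s : 'I_D, (entry x0 w s).1 != s.
  by apply/existsP; rewrite -negb_forall; apply/forallP.
by rewrite (bigD1 s) //= E (negbTE ws) mul0r.
Qed.

Let summand (w : W) : F := orient F en (entry x0 w) * (mixed_form 0 (0 : V) w * euler_form lab (0 : V) w).

(** A determinant of labels is nonzero exactly when the labels are distinct. *)
Let summandP (w : W) : reflect
  [/\ injective w, forall s : 'I_D, (entry x0 w s).1 = s &
      forall a : 'I_D, {in gtn q.+1 &, injective (fun i => top_label nu (dirs w) (a * q + i))}]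
  (summand w != 0).
Proof.
rewrite /summand mixed_center; apply: (iffP idP).
  rewrite mulf_eq0 negb_or => /andP[o0]; rewrite mulf_eq0 negb_or => /andP[].
  case: forallP => [w1 _|_]; last by rewrite eqxx.
  have wi : injective w.
    move=> i j; rewrite -!(entry_ord x0) => /(orient_inj o0) H.
    by apply: val_inj; apply: H; rewrite inE.
  have {}w1 (s : 'I_D) : (entry x0 w s).1 = s by apply/eqP.
  rewrite euler_form_center // => e0; split=> // a.
  apply: (@orient_inj F _ _ id); rewrite -/(degree_form F _).
  by apply: contraNneq e0 => E; rewrite (bigD1 a) //= E mul0r.
case=> wi w1 win.
have -> : [forall s : 'I_D, (entry x0 w s).1 == s] by apply/forallP => s; rewrite w1.
rewrite mul1r mulf_neq0 //.
  apply: (orient_neq0 _ enK rkK) => i j; rewrite !inE => ilt jlt.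
  exact: (entry_inj wi).
rewrite euler_form_center //; apply/prodf_neq0 => a _.
by apply: (@orient_neq0 F _ _ id id).
Qed.

Let om := omitted nu.
Let card_Zp : #|'Z_p| = q.+1. Proof. by rewrite card_ord. Qed.

Let bound (i : 'I_n) : (i < D + D * q)%N.
Proof. by apply: leq_trans (ltn_ord i) _; rewrite card_directions. Qed.

Let flag_dir m : I := (inord (m %/ q), nth 0 (block_order q nu (m %/ q)) (m %% q)).

Let flag_entry i : I :=
  if (i < D)%N then (inord i, om i) else flag_dir (i - D).

Let flag_word : W := [ffun i : 'I_n => flag_entry i].

Let flag_entryE i : (i < n)%N -> entry x0 flag_word i = flag_entry i.
Proof. by move=> ilt; rewrite -[i]/(val (Ordinal ilt)) entry_ord ffunE. Qed.

Let flag_dirsE (a : 'I_D) i : (i < q)%N ->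
  dirs flag_word (a * q + i) = (a, nth 0 (block_order q nu a) i).
Proof.
move=> iq.
have iN : (a * q + i < D * q)%N.
  by rewrite (leq_trans (n := a * q + q)%N) ?ltn_add2l // -mulSnr leq_mul2r ltn_ord orbT.
rewrite /dirs flag_entryE; last by rewrite card_directions ltn_add2l.
rewrite /flag_entry ltnNge leq_addr /= addKn /flag_dir.
rewrite divnMDl // divn_small // addn0 modnMDl modn_small //.
by rewrite inord_val.
Qed.

Let flag_startE (s : 'I_D) : entry x0 flag_word s = (s, om s).
Proof.
rewrite flag_entryE; last by rewrite card_directions (leq_trans (ltn_ord s)) ?leq_addr.
by rewrite /flag_entry ltn_ord inord_val.
Qed.

Let flag_summand : summand flag_word != 0.
Proof.
have fi := flag_inj nu_in card_Zp flag_dirsE.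
have fa := flag_avoids nu_in card_Zp flag_dirsE.
apply/summandP; split.
- move=> i j; rewrite -!(entry_ord x0) => E; apply: val_inj => /=; move: E.
  move: (bound i) (bound j).
  move: (nat_of_ord i) (nat_of_ord j) => {}i {}j in_ jn.
  have low a : (a < D)%N -> entry x0 flag_word a = (inord a, om a).
    move=> aD; have -> : inord a = Ordinal aD by apply: val_inj; rewrite /= inordK.
    exact: (flag_startE (Ordinal aD)).
  have high a : (D <= a)%N -> entry x0 flag_word a = dirs flag_word (a - D).
    by move=> Da; rewrite /dirs subnKC.
  have [iD|iD] := ltnP i D; have [jD|jD] := ltnP j D.
  + by rewrite !low // => /(congr1 fst) /(congr1 (@nat_of_ord _)) /=; rewrite !inordK.
  + rewrite low // high // => /esym/eqP E; exfalso.
    move: E; have := fa (j - D)%N (inord i); rewrite ltn_subLR // inordK // => /(_ jn).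
    by move=> /negbTE ->.
  + rewrite high // low // => /eqP E; exfalso.
    move: E; have := fa (i - D)%N (inord j); rewrite ltn_subLR // inordK // => /(_ in_).
    by move=> /negbTE ->.
  rewrite !high // => /fi; rewrite !inE !ltn_subLR // => /(_ in_ jn) E.
  by rewrite -(subnKC iD) E subnKC.
- by move=> s; rewrite flag_startE.
exact: (flag_windows nu_in card_Zp flag_dirsE).
Qed.

Let summand_unique w : summand w != 0 -> w = flag_word.
Proof.
move=> /summandP[wi w1 win].
have cov (x : I) : x = (x.1, (entry x0 w x.1).2) \/ exists2 j, (j < D * q)%N & dirs w j = x.
  have [|g _ gK] := inj_card_bij wi; first by rewrite card_ord.
  have := gK x; rewrite -(entry_ord x0); set i := g x => <-.
  have iN := bound i.
  have [iD|iD] := ltnP i D.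
    left; have := w1 (Ordinal iD) => /= E1; rewrite {2}E1 /=.
    exact: surjective_pairing.
  by right; exists (i - D)%N; rewrite ?ltn_subLR // /dirs subnKC.
have U := flag_unique nu_in card_Zp (dirs_inj wi) (dirs_avoid wi w1) cov win.
apply/ffunP => i; rewrite -!(entry_ord x0).
have iN := bound i.
have [iD|iD] := ltnP i D.
  have := flag_startE (Ordinal iD) => /= ->.
  by rewrite [LHS]surjective_pairing (w1 (Ordinal iD)); case: (U (Ordinal iD)) => /= ->.
have iN' : (i - D < D * q)%N by rewrite ltn_subLR.
have [a [j jq E]] := flag_decomp iN'.
rewrite -(subnKC iD) -!/(dirs _ _) E flag_dirsE //.
have [_ <-] := U a; rewrite nth_mkseq // [LHS]surjective_pairing; congr (_, _).
apply: val_inj; rewrite /= (block_of card_Zp (dirs_inj wi) (dirs_avoid wi w1) win) -?E //.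
by rewrite E divnMDl // divn_small // addn0.
Qed.

(** Exactly one word contributes, and its contribution is a product of signs. *)
Lemma center_neq0 :
  \sum_(w : W) orient F en (entry x0 w) * (mixed_form 0 (0 : V) w * euler_form lab (0 : V) w) != 0.
Proof.
rewrite (bigD1 flag_word) //= big1 ?addr0 ?flag_summand // => w.
by apply: contraNeq => /summand_unique ->.
Qed.

End CenterTerm.

(** * Equivariant labels and the discrete theorem *)

Lemma coprime_iter_fixed (X : Type) (g : X -> X) p e x :
  coprime e p -> (0 < e)%N -> iter p g x = x -> iter e g x = x -> g x = x.
Proof.
move=> cep e0 gp ge.
have iterM m c : iter m g x = x -> iter (c * m) g x = x.
  by move=> gm; elim: c => [//|c IH]; rewrite mulSn iterD IH.
have [u v E _] := egcdnP p e0; rewrite (eqP cep) in E.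
by have := iterM _ u ge; rewrite E addn1 iterS iterM.
Qed.

Section EquivariantChoice.
Variables (p : nat) (X : finType) (g : X -> X) (S : X -> {set 'Z_p}).
Hypotheses (p_prime : prime p) (g_inj : injective g) (g_iter : forall x, iter p g x = x).
Hypotheses (S0 : forall x, S x != set0) (S_turn : forall x i, (i + 1 \in S (g x)) = (i \in S x)).

(** A set of admissible labels that moves with the shift contains an equivariant
    choice off the fixed points, as the other orbits of a group of prime order are
    free. *)
Lemma equivariant_choice : exists l : X -> 'Z_p,
  (forall x, l x \in S x) /\ (forall x, g x != x -> l (g x) = l x + 1).
Proof.
have csym : connect_sym (frel g) by exact: fconnect_sym.
pose r x := froot g x.
have rx x : fconnect g (r x) x by rewrite csym; exact: connect_root.
pose m x := findex g (r x) x.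
have mE x : iter (m x) g (r x) = x by exact: iter_findex.
pose c x := odflt 0 [pick i in S x].
have cS x : c x \in S x.
  rewrite /c; case: pickP => [i //|none]; have /set0Pn[i] := S0 x; by rewrite none.
have p1 := prime_gt1 p_prime.
exists (fun x => c (r x) + (m x)%:R); split=> x.
  rewrite -[X in S X]mE; elim: (m x) => [|a IH]; first by rewrite addr0.
  by rewrite iterS -natr1 addrA S_turn.
move=> gx; have rgx : r (g x) = r x.
  apply/eqP; rewrite /r root_connect // csym; apply: connect1; exact/eqP.
rewrite rgx -addrA natr1; congr (_ + _); apply/eqP; rewrite -subr_eq0; apply: contraNT gx => d.
suff : g (g x) = g x by move/g_inj=> /eqP.
have fixed e : (p %| e)%N = false -> iter e g (g x) = g x -> g (g x) = g x.
  move=> pe; apply: (@coprime_iter_fixed _ _ p) => //; last by case: e pe; rewrite ?dvdn0.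
  by rewrite coprime_sym prime_coprime // pe.
have E1 : iter (m x).+1 g (r x) = g x by rewrite iterS mE.
have E2 : iter (m (g x)) g (r x) = g x by rewrite -rgx mE.
have natE e : (e%:R != 0 :> 'Z_p) -> (p %| e)%N = false.
  by move=> e0; apply: contraNF e0 => /dvdnP[b ->]; rewrite natrM pchar_Zp // mulr0.
have [le|/ltnW le] := leqP (m x).+1 (m (g x)).
  apply: (fixed (m (g x) - (m x).+1)%N); first by apply: natE; rewrite natrB.
  by rewrite -[X in iter _ g X]E1 -iterD subnK.
apply: (fixed ((m x).+1 - m (g x))%N); first by apply: natE; rewrite natrB // -oppr_eq0 opprB.
by rewrite -[X in iter _ g X]E2 -iterD subnK.
Qed.

End EquivariantChoice.

Section DiscreteTheorem.
Variables (p D' k : nat).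
Hypotheses (p_prime : prime p) (p_odd : odd p) (k3 : (2 < k)%N).

Local Opaque entry swap_entries.

Local Notation D := D'.+1.
Local Notation I := ('I_D'.+1 * 'Z_p)%type.
Local Notation V := {ffun 'I_D'.+1 * 'Z_p -> 'Z_(8 * k)}.
Local Notation q := (Zp_trunc p).+1.
Local Notation step := (@unit_step p D'.+1 k).

Variable L : nat -> V -> 'Z_p.
Hypothesis L_turn : forall a v, turn v != v -> L a (turn v) = L a v + 1.

Definition turn_set (B : {set 'Z_p}) : {set 'Z_p} := [set i | i - 1 \in B].

Lemma turn_set_fixed B : turn_set B = B -> B != set0 -> B = setT.
Proof.
move=> /setP rB /set0Pn[i iB].
have all m : i + m%:R \in B.
  by elim: m => [|m IH]; rewrite ?addr0 // -natr1 addrA -rB inE addrK.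
by apply/setP => j; rewrite inE -(addrNK i j) addrC -[j - i]natr_Zp all.
Qed.

(** The empty set and the full set are invariant, so no element of them can be chosen
    equivariantly. *)
Lemma nu_exists : exists nu : {set 'Z_p} -> 'Z_p,
  (forall B : {set 'Z_p}, B != set0 -> nu B \in B) /\
  (forall B, B != set0 -> B != setT -> nu (turn_set B) = nu B + 1).
Proof.
have iterE m B : iter m turn_set B = [set i | i - m%:R \in B].
  elim: m => [|m IH]; first by apply/setP => i; rewrite inE subr0.
  by apply/setP => i; rewrite iterS IH !inE -natr1 opprD addrAC addrA.
have [||||nu [nuS nu_turn]] := @equivariant_choice p _ turn_set
  (fun B => if B == set0 then setT else B) p_prime.
- move=> B C /setP E; apply/setP => i; have := E (i + 1); by rewrite !inE addrK.
- move=> B; rewrite iterE; apply/setP => i; rewrite inE pchar_Zp ?subr0 //.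
  exact: prime_gt1.
- move=> B; case: ifP => [_|/negbT //]; apply/set0Pn; exists 0; by rewrite inE.
- move=> B i; have -> : (turn_set B == set0) = (B == set0).
    apply/eqP/eqP => [/setP E|->]; apply/setP => j; last by rewrite !inE.
    by have := E (j + 1); rewrite !inE addrK.
  by case: ifP; rewrite !inE // addrK.
exists nu; split=> [B B0|B B0 BT]; first by have := nuS B; rewrite (negbTE B0).
by apply: nu_turn; apply: contraNneq BT => /turn_set_fixed ->.
Qed.

Let support (v : V) : {set I} := [set x | v x == 1].
Let in_unit_cube (v : V) := [forall x, (v x == 0) || (v x == 1)].

Lemma top_slice_turn v : top_slice (support (turn v)) = turn_set (top_slice (support v)).
Proof.
have sE s : slice (support (turn v)) s = turn_set (slice (support v) s).
  by apply/setP => i; rewrite !inE ffunE.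
have s0 s : (slice (support (turn v)) s == set0) = (slice (support v) s == set0).
  rewrite sE; apply/eqP/eqP => [/setP E|->]; apply/setP => j; last by rewrite !inE.
  by have := E (j + 1); rewrite !inE addrK.
rewrite /top_slice.
rewrite (@eq_pick _ _ (fun s => (slice (support v) s != set0) &&
   [forall s' : 'I_D, (s < s')%N ==> (slice (support v) s' == set0)])); last first.
  by move=> s; rewrite /= s0; congr (_ && _); apply: eq_forallb => s'; rewrite s0.
case: pickP => [s _|_]; first exact: sE.
by apply/setP => i; rewrite !inE.
Qed.

Lemma in_unit_cube_turn v : in_unit_cube (turn v) = in_unit_cube v.
Proof.
apply/forallP/forallP => H x; last by rewrite ffunE.
by have := H (turn_dir x); rewrite turn_turn_dir.
Qed.

Lemma support_vertex B : support (vertex_of k B) = B.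
Proof.
apply/setP => x; rewrite inE ffunE; case: (x \in B); first by rewrite eqxx.
by rewrite eq_sym; apply/negbTE.
Qed.

(** Near the apex the given labels are overridden by the prescribed ones.  This is
    harmless: a base point that is far from the diagonal has no vertex of the unit
    cube at the origin in its own unit cube.  If no base point were as required, the
    Euler cocycle would vanish far from the diagonal, and [center_eq0] would contradict
    [center_neq0]. *)
Lemma discrete_theorem : exists v : V,
  [/\ forall s, (v (s, 0%R) <= 2 * k)%N,
      exists s i, far k (v (s, i)) (v (s, 0%R)) &
      forall (a : 'I_D) i, exists B : {set I}, L a (v + vertex_of k B) = i].
Proof.
pose good (v : V) := [&& [forall s, (v (s, 0%R) <= 2 * k)%N],
  [exists s, exists i, far k (v (s, i)) (v (s, 0%R))] &
  [forall a : 'I_D, forall i, exists B : {set I}, L a (v + vertex_of k B) == i]].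
case: (pickP good) => [v /and3P[/forallP v0 /existsP[s /existsP[i f]] /forallP all]|none].
  exists v; split=> //; first by exists s, i.
  by move=> a j; have /forallP/(_ j)/existsP[B /eqP E] := all a; exists B.
exfalso.
have [nu [nu_in nu_turn]] := nu_exists.
pose lab (a : nat) (v : V) := if in_unit_cube v && (top_slice (support v) != setT) then nu (top_slice (support v))
                else L a v.
have lab_turn a v : turn v != v -> lab a (turn v) = lab a v + 1.
  move=> rv; rewrite /lab in_unit_cube_turn top_slice_turn.
  have -> : (turn_set (top_slice (support v)) == setT) = (top_slice (support v) == setT).
    apply/eqP/eqP => [/setP E|->]; apply/setP => j; last by rewrite !inE.
    by have := E (j + 1); rewrite !inE addrK.
  case: ifP => [/andP[uv nT]|_]; last exact: L_turn.
  apply: nu_turn => //; apply: contraNneq rv => T0; apply/eqP.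
  suff -> : v = 0 by apply/ffunP => x; rewrite !ffunE.
  apply/ffunP => x; rewrite [RHS]ffunE.
  have := forallP uv x; case/orP => /eqP // x1.
  have xB : x \in support v by rewrite inE x1.
  have [s [_ tE s0 _]] := top_slice_exists xB.
  by rewrite -tE T0 eqxx in s0.
have lab_center a (B : {set I}) : (forall s, exists i, (s, i) \notin B) ->
    lab a (vertex_of k B) = nu (top_slice B).
  move=> nonfull; rewrite /lab support_vertex ifT //; apply/andP; split.
    by apply/forallP => x; rewrite ffunE; case: (x \in B); rewrite eqxx ?orbT.
  apply/eqP; rewrite /top_slice; case: pickP => [s _|_] /setP.
    by have [i iB] := nonfull s; move=> /(_ i); rewrite !inE (negbTE iB).
  by move=> /(_ 0); rewrite !inE.
have far_not_unit (v : V) (B : {set I}) : (forall s, (v (s, 0%R) <= 2 * k)%N) ->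
    (exists s i, far k (v (s, i)) (v (s, 0%R))) -> in_unit_cube (v + vertex_of k B) = false.
  move=> v0 [s [i f]]; apply/negbTE/negP => /forallP unit_.
  have val (x : I) : (v x <= 1)%N \/ (v x = (8 * k).-1 :> nat).
    have N1 : ((-1 : 'Z_(8 * k)) = (8 * k).-1 :> nat).
      have Z0 : (0 : 'Z_(8 * k)) = 0%N :> nat by [].
      by rewrite -sub0r Zm_valB // Zm_val1 Z0 ltnn add0n subn1.
    have := unit_ x; rewrite !ffunE.
    case: (x \in B) => /orP[] /eqP E.
    - by right; rewrite -N1; congr nat_of_ord; apply/eqP; rewrite -addr_eq0 E.
    - by left; move/eqP: E; rewrite -subr_eq0 addrK => /eqP ->.
    - by left; move: E; rewrite addr0 => ->.
    - by left; move: E; rewrite addr0 => ->; rewrite Zm_val1.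
  have := v0 s; move: f; rewrite /far; move: (val (s, i)) (val (s, 0)).
  by move: (nat_of_ord (v (s, i))) (nat_of_ord (v (s, 0))) => a c; lia.
have euler_form_far (v : V) (w : {ffun 'I_#|{: I}| -> I}) : injective w ->
    (forall s, v (s, 0%R) <= 2 * k)%N ->
    (exists s i, far k (v (s, i)) (v (s, 0%R))) -> euler_form lab v w = 0.
  move=> wi v0 vfar; have := none v; rewrite /good.
  have -> : [forall s, (v (s, 0%R) <= 2 * k)%N] by apply/forallP.
  have -> : [exists s, exists i, far k (v (s, i)) (v (s, 0%R))].
    by have [s [i f]] := vfar; apply/existsP; exists s; apply/existsP; exists i.
  move=> /= /negbT; rewrite negb_forall => /existsP[a].
  rewrite negb_forall => /existsP[i]; rewrite negb_exists => /forallP miss.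
  rewrite /euler_form cup_form_prod (bigD1 a) //= (_ : block_form _ _ _ _ = 0) ?mul0r //.
  apply/eqP; apply: contraT => /orient_inj inj.
  pose h (j : 'I_q.+1) : 'Z_p := lab a (shift (a * q)
    (lattice_path step v (fun i => entry (ord0, 0) w (D + i))) j).
  have hi : injective h by move=> j j' /inj E; apply: val_inj; apply: E; rewrite inE.
  have [h' _ hK] := inj_card_bij hi (leqnn _).
  have := hK i; rewrite /h /shift.
  set m := (a * q + _)%N; set u := fun i => _.
  have mN : (m <= D * q)%N.
    rewrite -ltnS (leq_trans (n := a * q + q.+1)%N) // ?ltn_add2l ?ltn_ord //.
    by rewrite addnS ltnS -mulSnr leq_mul2r ltn_ord orbT.
  have -> : lattice_path step v u m = v + vertex_of k (prefix_set u m).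
    rewrite -lattice_path_center; first by rewrite /lattice_path add0r.
    move=> b c bm cm /(entry_inj wi) E; apply: (@addnI D); apply: E.
      by rewrite card_directions ltn_add2l (leq_trans bm).
    by rewrite card_directions ltn_add2l (leq_trans cm).
  rewrite /lab far_not_unit //= => E.
  by have := miss (prefix_set u m); rewrite E eqxx.
have := center_neq0 k3 nu_in lab_center.
by rewrite center_eq0 ?eqxx.
Qed.

End DiscreteTheorem.

From mathcomp Require Import all_classical all_reals all_analysis.
Import Order.TTheory GRing.Theory Num.Theory.
Import numFieldNormedType.Exports.
Local Open Scope classical_set_scope.
Local Open Scope ring_scope.

(** * A map from R^d onto the sphere *)

Section SphereChart.
Variables (R : realType) (D' : nat).
Local Notation d := D'.+1.
Implicit Types y z : 'rV[R]_d.

Lemma cvg_mx_coord (X : Type) (m n : nat) (F : set_system X) {FF : Filter F}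
    (f : X -> 'M[R]_(m, n)) (M : 'M[R]_(m, n)) :
  (forall i j, (fun x => f x i j) @ F --> M i j) -> f @ F --> M.
Proof.
move=> H A [P MP PA]; rewrite /nbhs /=.
have : \forall x \near F, forall i j, P i j (f x i j).
  apply: filter_forall => i; apply: filter_forall => j; exact: H.
by apply: filterS => x Px; apply: PA.
Qed.

(** Stereographic projection of y / height y.  The height is 1 on the cube of radius
    1/2 and decreases to 0 on the boundary of the unit cube, which is sent to the
    pole; the vector norm is the sup norm. *)
Definition height y : R := Num.min 1 (Num.max 0 (2 - 2 * `|y|)).
Definition sqnorm y : R := \sum_i y ord0 i ^+ 2.
Definition chart_denom y : R := sqnorm y + height y ^+ 2.
Definition chart y : 'rV[R]_d.+1 :=
  \row_j (if unlift ord0 j is Some i then 2 * height y * y ord0 i / chart_denom y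
          else (sqnorm y - height y ^+ 2) / chart_denom y).

Lemma entry_le_norm y t : `|y ord0 t| <= `|y|.
Proof.
rewrite [leRHS]/Num.Def.normr /= mx_normrE.
exact: (le_bigmax _ (fun ij : 'I_1 * 'I_d => `|y ij.1 ij.2|) (ord0, t)).
Qed.

Lemma norm_le_entries y e : 0 <= e -> (forall t, `|y ord0 t| <= e) -> `|y| <= e.
Proof.
move=> e0 ye; rewrite [leLHS]/Num.Def.normr /= mx_normrE bigmax_le //= => -[i t] _.
by rewrite (ord1 i).
Qed.

Lemma height_ge0 y : 0 <= height y.
Proof. by rewrite /height le_min ler01 le_max lexx. Qed.

Lemma height_small y : `|y| <= 2^-1 -> height y = 1.
Proof.
move=> y1; rewrite /height min_l // le_max; apply/orP; right; lra.
Qed.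

Lemma height_big y : 1 <= `|y| -> height y = 0.
Proof.
move=> y1; rewrite /height; have -> : Num.max 0 (2 - 2 * `|y|) = 0 by rewrite max_l //; lra.
by rewrite min_r.
Qed.

Lemma sqnorm_ge0 y : 0 <= sqnorm y.
Proof. by apply: sumr_ge0 => i _; exact: sqr_ge0. Qed.

Lemma sqnorm_eq0 y : sqnorm y = 0 -> y = 0.
Proof.
move/eqP; rewrite psumr_eq0 => [/allP H|i _]; last exact: sqr_ge0.
apply/rowP => i; rewrite mxE; apply/eqP.
by have := H i; rewrite mem_index_enum sqrf_eq0 => /(_ isT).
Qed.

Lemma chart_denom_gt0 y : 0 < chart_denom y.
Proof.
rewrite /chart_denom lt_neqAle addr_ge0 ?sqnorm_ge0 ?sqr_ge0 // andbT eq_sym.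
apply/eqP => E; have /eqP := E; rewrite paddr_eq0 ?sqnorm_ge0 ?sqr_ge0 //.
move=> /andP[/eqP/sqnorm_eq0 ->]; rewrite height_small ?normr0 ?invr_ge0 //.
by rewrite expr1n oner_eq0.
Qed.

Lemma chart_sphere y : sphere R d (chart y).
Proof.
have D0 := lt0r_neq0 (chart_denom_gt0 y).
rewrite /sphere /= /euclidean_dist big_ord_recl /= !mxE unlift_none.
under eq_bigr => i _ do rewrite !mxE liftK sub0r sqrrN exprMn exprMn exprVn.
rewrite -mulr_suml -mulr_sumr -/(sqnorm y) sub0r sqrrN exprMn exprVn -mulrDl.
have -> : (sqnorm y - height y ^+ 2) ^+ 2 + (2 * height y) ^+ 2 * sqnorm y =
  chart_denom y ^+ 2 by rewrite /chart_denom; ring.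
by rewrite mulfV ?sqrf_eq0 // sqrtr1.
Qed.

Lemma chart_pole y z : 1 <= `|y| -> 1 <= `|z| -> chart y = chart z.
Proof.
move=> y1 z1; apply/rowP => j; rewrite !mxE.
have := chart_denom_gt0 y; have := chart_denom_gt0 z.
rewrite /chart_denom !height_big // expr0n /= !addr0 => z0 y0.
case: (unlift _ _) => [i|]; first by rewrite !mulr0 !mul0r.
by rewrite !subr0 !mulfV ?lt0r_neq0.
Qed.

(** Equality of the images gives y = z / height z.  If the height of z were less than 1,
    then |z| > 1/2 and y would leave the cube of radius 1/2.  The points y of this
    cube are thus separated from all points, not only from those of the cube. *)
Lemma chart_inj y z : `|y| <= 2^-1 -> chart y = chart z -> y = z.
Proof.
move=> y1 /rowP E.
have Dy := lt0r_neq0 (chart_denom_gt0 y); have Dz := lt0r_neq0 (chart_denom_gt0 z).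
have h1 : height y = 1 by exact: height_small.
have E0 : height z ^+ 2 / chart_denom z = 1 / chart_denom y.
  have aux (x : 'rV[R]_d) : (sqnorm x - height x ^+ 2) / chart_denom x =
      1 - 2 * (height x ^+ 2 / chart_denom x).
    by have := lt0r_neq0 (chart_denom_gt0 x); rewrite /chart_denom => H; field.
  have := E ord0; rewrite !mxE unlift_none !aux h1 expr1n => H.
  move: H; move: (1 / chart_denom y) (height z ^+ 2 / chart_denom z) => a b; lra.
have Hz : height z != 0.
  apply: contraPneq E0 => ->; rewrite expr0n mul0r => /esym/eqP.
  by rewrite mulf_eq0 oner_eq0 invr_eq0 (negbTE Dy).
have yz : y = (height z)^-1 *: z.
  apply/rowP => i; have := E (lift ord0 i); rewrite !mxE liftK h1 => Ei.
  have : height z ^+ 2 / chart_denom z * y ord0 i = height z * z ord0 i / chart_denom z.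
    rewrite E0; have : 2 * (1 * y ord0 i / chart_denom y) = 2 * (height z * z ord0 i / chart_denom z).
      by rewrite !mulrA mulr1 in Ei *.
    by move/(mulfI (_ : 2 != 0)) => <- //; rewrite mulrAC.
  move/(congr1 (fun x => x * chart_denom z / height z ^+ 2)) => H.
  by move: H; have -> : height z ^+ 2 / chart_denom z * y ord0 i * chart_denom z / height z ^+ 2
    = y ord0 i by [field; rewrite Hz]; move=> ->; field; rewrite Hz.
have [zs|zb] := leP `|z| 2^-1; first by rewrite yz height_small // invr1 scale1r.
exfalso; move: y1; rewrite yz normrZ normfV ger0_norm ?height_ge0 //.
have H0 : 0 < height z by rewrite lt_neqAle eq_sym Hz height_ge0.
rewrite mulrC ler_pdivrMr //.
have : height z <= 1 by rewrite /height ge_min lexx.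
lra.
Qed.

Lemma chart_continuous : continuous chart.
Proof.
have coord i : continuous (fun y : 'rV[R]_d => y ord0 i) by exact: coord_continuous.
have sq_c : continuous sqnorm.
  rewrite /sqnorm; elim: (index_enum _) => [|i r IH].
    rewrite (_ : (fun y => _) = cst 0); first exact: cst_continuous.
    by apply/funext => y; rewrite big_nil.
  rewrite (_ : (fun y => _) = (fun y => y ord0 i * y ord0 i + \sum_(j <- r) y ord0 j ^+ 2)).
    by move=> y; exact: (cvgD (cvgM (coord i y) (coord i y)) (IH y)).
  by apply/funext => y; rewrite big_cons expr2.
have h_c : continuous height.
  move=> y; have c0 (c : R) : {for y, continuous (fun=> c : R^o)} by apply: cst_continuous.
  have c1 : {for y, continuous (fun x => 2 - 2 * `|x| : R^o)}.
    exact: (cvgB (cvg_cst _) (cvgM (cvg_cst _) (@norm_continuous _ _ y))).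
  exact: (continuous_min (c0 1) (continuous_max (c0 0) c1)).
have h2_c : continuous (fun y => height y ^+ 2).
  rewrite (_ : (fun y => _) = (fun y => height y * height y)); last first.
    by apply/funext => y; rewrite expr2.
  by move=> y; exact: (cvgM (h_c y) (h_c y)).
have d_c : continuous (fun y => (chart_denom y)^-1).
  have dc : continuous chart_denom by move=> y; exact: (cvgD (sq_c y) (h2_c y)).
  by move=> y; exact: (continuousV (lt0r_neq0 (chart_denom_gt0 y)) (dc y)).
move=> y; apply: (@cvg_mx_coord _ _ _ (nbhs y) (nbhs_filter y)) => i j.
case u: (unlift ord0 j) => [a|].
  have -> : (fun x => chart x i j) = (fun x => 2 * height x * x ord0 a / chart_denom x).
    by apply/funext => x; rewrite mxE u.
  rewrite [chart y i j]mxE u.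
  have t1 : continuous (fun x => 2 * height x).
    by move=> x; exact: (cvgM (cvg_cst _) (h_c x)).
  have t2 : continuous (fun x : 'rV[R]_d => 2 * height x * x ord0 a).
    by move=> x; exact: (cvgM (t1 x) (coord a x)).
  have t3 : continuous (fun x : 'rV[R]_d => 2 * height x * x ord0 a / chart_denom x).
    by move=> x; exact: (cvgM (t2 x) (d_c x)).
  exact: (t3 y).
have -> : (fun x => chart x i j) = (fun x => (sqnorm x - height x ^+ 2) / chart_denom x).
  by apply/funext => x; rewrite mxE u.
rewrite [chart y i j]mxE u.
have t1 : continuous (fun x => sqnorm x - height x ^+ 2).
  by move=> x; exact: (cvgB (sq_c x) (h2_c x)).
have t2 : continuous (fun x => (sqnorm x - height x ^+ 2) / chart_denom x).
  by move=> x; exact: (cvgM (t1 x) (d_c x)).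
exact: (t2 y).
Qed.

End SphereChart.

(** * From labels to metrics, and the limit *)

(** The balls of rho are rho-open by the triangle inequality, hence open. *)
Lemma metric_near (R : realType) (n : nat) (rho : 'rV[R]_n.+1 -> 'rV[R]_n.+1 -> R) :
  is_metric rho -> equivalent_metrics rho (@euclidean_dist R n.+1) ->
  forall u e, 0 < e -> \forall v \near u, rho u v < e.
Proof.
move=> [ge0 eq0 sym tri] eqv u e e0.
have : open [set v | rho u v < e].
  apply/euclidean_openE/eqv => v /= uv; exists (e - rho u v); first by rewrite subr_gt0.
  by move=> w /= vw; have := tri u v w; lra.
rewrite openE => /(_ u); apply.
by rewrite /= (_ : rho u u = 0) //; apply/eq0.
Qed.

Section Configurations.
Variables (R : realType) (p D' : nat).
Hypotheses (p_prime : prime p) (p_odd : odd p).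
Local Notation d := D'.+1.
Local Notation I := ('I_D'.+1 * 'Z_p)%type.
Local Notation n := #|{: 'I_D'.+1 * 'Z_p}|.
Local Notation conf := 'rV[R]_#|{: 'I_D'.+1 * 'Z_p}|.

Variables (f : 'rV[R]_d.+1 -> 'rV[R]_d.+1) (rho : nat -> 'rV[R]_d.+1 -> 'rV[R]_d.+1 -> R).
Hypothesis f_cont : {within sphere R d, continuous f}.
Hypothesis rho_metric : forall j, (1 <= j <= p.-1 %/ 2)%N ->
  is_metric (rho j) /\ equivalent_metrics (rho j) (@euclidean_dist R d.+1).

Definition coordinate (Y : conf) (x : I) : R := Y ord0 (enum_rank x).
Definition conf_of (h : I -> R) : conf := \row_c h (enum_val c).
Definition point (Y : conf) (i : 'Z_p) : 'rV[R]_d := \row_t coordinate Y (t, i).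
Definition image_point (Y : conf) i : 'rV[R]_d.+1 := f (chart (point Y i)).
(** The distance that the theorem asks to be independent of i. *)
Definition edge j i Y : R := rho j (image_point Y i) (image_point Y (i + j%:R)).

Lemma coordinate_conf h x : coordinate (conf_of h) x = h x.
Proof. by rewrite /coordinate mxE enum_rankK. Qed.

Lemma image_point_continuous i : continuous (image_point^~ i).
Proof.
have pt_c : continuous (point^~ i).
  move=> Y; apply: (@cvg_mx_coord _ _ _ _ (nbhs Y) (nbhs_filter Y)) => a t.
  rewrite [point Y i a t]mxE.
  have -> : (fun x => point x i a t) = (fun x : conf => x ord0 (enum_rank (t, i))).
    by apply/funext => x; rewrite mxE.
  exact: coord_continuous.
have c_c : continuous (fun Y => chart (point Y i)).
  by move=> Y; apply: continuous_comp; [exact: pt_c|exact: chart_continuous].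
move=> Y; have /subspace_continuousP/(_ _ (chart_sphere (point Y i))) fc := f_cont.
apply: cvg_trans fc => A /= fA; rewrite /nbhs /= in fA *.
apply: (@filterS _ (nbhs Y) (nbhs_filter Y) _ _ _ (c_c Y _ fA)) => Z /= H.
by apply: H; exact: chart_sphere.
Qed.

Lemma edge_near j i Y e : (1 <= j <= p.-1 %/ 2)%N -> 0 < e ->
  \forall Z \near Y, `|edge j i Z - edge j i Y| < e.
Proof.
move=> jm e0; have [met eqv] := rho_metric jm.
have e2 : 0 < e / 2 by lra.
have nearP a : \forall Z \near Y, rho j (image_point Y a) (image_point Z a) < e / 2.
  exact: (image_point_continuous (metric_near met eqv _ e2)).
have [ge0 eq0 sym tri] := met.
near=> Z.
have A : rho j (image_point Y i) (image_point Z i) < e / 2 by near: Z; exact: nearP.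
have B : rho j (image_point Y (i + j%:R)) (image_point Z (i + j%:R)) < e / 2.
  by near: Z; exact: nearP.
move: A B; rewrite /edge.
set a := image_point Y i; set a' := image_point Z i; set b := image_point Y _; set b' := image_point Z _.
have := tri a' a b'; have := tri a b b'; have := tri a a' b; have := tri a' b' b.
rewrite (sym a' a) (sym b' b) => H1 H2 H3 H4 A B.
by rewrite ltr_norml; apply/andP; split; lra.
Unshelve. all: by end_near. Qed.

Variable idx : 'I_d -> nat.
Hypothesis idx_range : forall a, (1 <= idx a <= p.-1 %/ 2)%N.

Section Mesh.
Variable k : nat.
Hypothesis k3 : (2 < k)%N.
Local Notation T := 'Z_(8 * k).
Local Notation V := {ffun 'I_D'.+1 * 'Z_p -> 'Z_(8 * k)}.

Let h : R := (4 * k)%:R.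
Let h0 : 0 < h. Proof. by rewrite ltr0n; lia. Qed.

(** Representatives in [-4k, 4k), rescaled to [-1, 1). *)
Definition centered (x : T) : R :=
  (if (x < 4 * k)%N then (x : nat)%:R else (x : nat)%:R - (8 * k)%:R) / (4 * k)%:R.

Definition conf_at (v : V) : conf := conf_of (fun x => centered (v x)).

Lemma centered_le1 x : `|centered x| <= 1.
Proof.
rewrite /centered normrM normfV -/h (ger0_norm (ltW h0)) ler_pdivrMr // mul1r.
have := Zm_lt k3 x; move: (nat_of_ord x) => a a8; rewrite ler_norml /h.
case: ltnP => a4.
  have : a%:R <= (4 * k)%:R :> R by rewrite ler_nat ltnW.
  have : 0 <= a%:R :> R by exact: ler0n.
  by move=> A B; apply/andP; split; lra.
have -> : (8 * k)%:R = (4 * k)%:R + (4 * k)%:R :> R by rewrite -natrD; congr (_%:R); lia.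
have : (4 * k)%:R <= a%:R :> R by rewrite ler_nat.
have : a%:R <= (4 * k)%:R + (4 * k)%:R :> R by rewrite -natrD ler_nat; lia.
by move=> A B; apply/andP; split; lra.
Qed.

(** Opposite faces of the unit cube go to the pole, so the map to the sphere descends
    to the torus. *)
Lemma chart_wrap (y z : 'rV[R]_d) :
  (forall t, y ord0 t = z ord0 t \/ (y ord0 t = 1 /\ z ord0 t = -1)) -> chart y = chart z.
Proof.
move=> yz; have [[t [y1 z1]]|none] := pselect (exists t, y ord0 t = 1 /\ z ord0 t = -1).
  apply: chart_pole; first by rewrite (le_trans _ (entry_le_norm y t)) // y1 normr1.
  by rewrite (le_trans _ (entry_le_norm z t)) // z1 normrN1.
congr chart; apply/rowP => t; have [//|E] := yz t; exfalso; apply: none; by exists t.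
Qed.

(** The alternative is the step that wraps around. *)
Lemma centered_step (x : T) :
  centered (x + 1) = centered x + h^-1 \/
  (centered x + h^-1 = 1 /\ centered (x + 1) = -1).
Proof.
have hn0 : h != 0 by exact: lt0r_neq0.
have Zx := Zm_lt k3 x; have e8 : (8 * k)%:R = h + h :> R.
  by rewrite /h -natrD; congr (_%:R); lia.
rewrite /centered Zm_valD1 // -/h e8; move: (nat_of_ord x) Zx => a a8.
case: (ltnP a.+1 (8 * k)) => [a1|a1].
  case: (ltnP a (4 * k)) => a4; case: (ltnP a.+1 (4 * k)) => a5.
  - by left; rewrite -natr1 mulrDl mul1r.
  - right; have aE : a.+1 = (4 * k)%N by lia.
    have ah : a%:R + 1 = h by rewrite natr1 aE.
    rewrite -[X in _ + X]mul1r -mulrDl ah aE -/h mulfV //; split=> //.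
    by rewrite opprD addrA subrr sub0r mulNr mulfV.
  - lia.
  - by left; rewrite -natr1 addrAC mulrDl mul1r.
left; have aE : a.+1 = (8 * k)%N by lia.
have ah : a%:R + 1 = h + h by rewrite natr1 aE.
rewrite ifT; last by lia.
rewrite ifF; last by lia.
have -> : (a%:R - (h + h)) / h + h^-1 = (a%:R + 1 - (h + h)) / h.
  by rewrite addrAC [RHS]mulrDl mul1r.
by rewrite ah subrr !mul0r.
Qed.

(** The discrete theorem applied to labels that maximize the distances.  Each index i
    is a label at some vertex of one small cube, so each of the p distances is the
    largest one somewhere in that cube.  The point Z is this vertex, unwrapped so that
    it is close to Y also across the seam of the torus. *)
Lemma mesh_configuration : exists Y : conf,
  [/\ forall x, `|coordinate Y x| <= 1,
      forall t, 0 <= coordinate Y (t, 0) <= 2^-1,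
      exists t i, 4^-1 <= `|coordinate Y (t, i) - coordinate Y (t, 0)| &
      forall a i, exists2 Z : conf, (forall x, `|coordinate Z x - coordinate Y x| <= h^-1) &
        forall b, edge (idx a) b Z <= edge (idx a) i Z].
Proof.
pose S a (v : V) : {set 'Z_p} :=
  finset (fun i => [forall b, edge (idx a) b (conf_at v) <= edge (idx a) i (conf_at v)]).
have S0 a v : S a v != finset.set0.
  apply/set0Pn; pose G b := edge (idx a) b (conf_at v).
  exists [arg max_(i > 0 : 'Z_p) G i]%O; rewrite inE; apply/forallP => b.
  by case: arg_maxP => // i _ /(_ b isT).
have edge_turn j i (v : V) : edge j (i + 1) (conf_at (turn v)) = edge j i (conf_at v).
  rewrite /edge; have E c : image_point (conf_at (turn v)) (c + 1) = image_point (conf_at v) c.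
    congr (f (chart _)); apply/rowP => t; rewrite !mxE /coordinate !mxE !enum_rankK.
    by rewrite ffunE /= addrK.
  by rewrite -addrA (addrC 1) addrA !E.
have S_turn a v i : (i + 1 \in S a (turn v)) = (i \in S a v).
  rewrite !inE; apply/forallP/forallP => H b.
    by have := H (b + 1); rewrite !edge_turn.
  by have := H (b - 1); rewrite -(edge_turn _ (b - 1)) -(edge_turn _ i) subrK.
have turn_iter (v : V) : iter p (@turn p D' k) v = v.
  have E m : iter m (@turn p D' k) v = [ffun x => v (x.1, x.2 - m%:R)].
    elim: m => [|m IH]; first by apply/ffunP => -[s i]; rewrite ffunE /= subr0.
    by rewrite iterS IH; apply/ffunP => -[s i]; rewrite !ffunE /= -natr1 opprD addrAC addrA.
  rewrite E; apply/ffunP => -[s i]; rewrite ffunE /= pchar_Zp ?subr0 //.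
  exact: prime_gt1.
have Lex (a : 'I_d) : exists l : V -> 'Z_p,
    (forall v, l v \in S a v) /\ (forall v, turn v != v -> l (turn v) = l v + 1).
  exact: (equivariant_choice p_prime (@turn_inj p D' k) turn_iter (S0 a) (S_turn a)).
have [L HL] := choice Lex.
pose lab (a : nat) (v : V) : 'Z_p := L (inord a) v.
have lab_turn a v : turn v != v -> lab a (turn v) = lab a v + 1.
  by move=> rv; have [_] := HL (inord a); apply.
have [v [v0 [s [i vfar]] vlab]] := discrete_theorem p_prime p_odd k3 lab_turn.
have base t : centered (v (t, 0)) = (v (t, 0) : nat)%:R / h.
  by rewrite /centered ifT //; apply: leq_ltn_trans (v0 t) _; rewrite ltn_pmul2r //; lia.
exists (conf_at v); split.
- by move=> x; rewrite coordinate_conf centered_le1.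
- move=> t; rewrite coordinate_conf base; apply/andP; split.
    by rewrite divr_ge0 ?ler0n // ltW.
  rewrite ler_pdivrMr // (_ : 2^-1 * h = (2 * k)%:R) ?ler_nat //.
  by rewrite /h !natrM; field.
- exists s, i; rewrite !coordinate_conf base /centered -/h.
  have := Zm_lt k3 (v (s, i)); have := v0 s; move: vfar; rewrite /far.
  move: (nat_of_ord (v (s, i))) (nat_of_ord (v (s, 0))) => a c vfar c2 a8.
  have scale (u w : R) : u / h - w / h = (u - w) / h by rewrite mulrBl.
  rewrite scale normrM normfV (ger0_norm (ltW h0)) ler_pdivlMr //.
  have -> : 4^-1 * h = k%:R by rewrite /h natrM; field.
  case: ltnP => a4.
    have [ac|/ltnW ca] := leqP a c.
      by rewrite distrC -natrB // ger0_norm ?ler0n // ler_nat; lia.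
    by rewrite -natrB // ger0_norm ?ler0n // ler_nat; lia.
  have -> : a%:R - (8 * k)%:R - c%:R = - (8 * k + c - a)%:R :> R.
    by rewrite natrB ?natrD; [ring|lia].
  by rewrite normrN ger0_norm ?ler0n // ler_nat; lia.
move=> a j; have [B labB] := vlab a j.
pose Z := conf_of (fun x => centered (v x) + (x \in B)%:R / h).
exists Z => [x|b].
  rewrite !coordinate_conf addrAC subrr add0r; case: (x \in B).
    by rewrite mul1r ger0_norm // invr_ge0 ltW.
  by rewrite mul0r normr0 invr_ge0 ltW.
have ZE c : image_point Z c = image_point (conf_at (v + vertex_of k B)) c.
  congr (f _); apply: chart_wrap => t; rewrite !mxE !coordinate_conf !ffunE.
  case: ((t, c) \in B); last by left; rewrite mul0r addr0 addr0.
  by rewrite mul1r; case: (centered_step (v (t, c))) => [->|[-> ->]]; [left|right].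
have EE c : edge (idx a) c Z = edge (idx a) c (conf_at (v + vertex_of k B)).
  by rewrite /edge !ZE.
rewrite !EE; have [inS _] := HL a; have := inS (v + vertex_of k B).
have -> : L a (v + vertex_of k B) = j by rewrite -labB /lab inord_val.
by rewrite inE => /forallP.
Qed.

End Mesh.

Lemma near_trans (w y z e r : R) :
  `|y - w| < r / 2 -> `|z - y| <= e -> e <= r / 2 -> `|w - z| < r.
Proof.
rewrite !ltr_norml ler_norml => /andP[A1 A2] /andP[B1 B2] er.
by apply/andP; split; lra.
Qed.

(** A cluster point of the mesh configurations.  If one distance were strictly larger
    than another at the limit, it would be larger on a whole ball, which contains a
    vertex where the other distance is the largest. *)
Lemma limit_configuration : exists Y : conf,
  [/\ forall t, 0 <= coordinate Y (t, 0) <= 2^-1,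
      exists t i, coordinate Y (t, i) != coordinate Y (t, 0) &
      forall a i b, edge (idx a) b Y = edge (idx a) i Y].
Proof.
have [Y_ HY] := choice (fun m => mesh_configuration (isT : 2 < m.+3)%N).
pose K : set conf := [set Y | forall c, `[(-1 : R), 1]%classic (Y ord0 c)].
have Kc : compact K.
  by apply: (@rV_compact _ _ (fun=> `[(-1 : R), 1]%classic)) => c; exact: segment_compact.
have YK m : K (Y_ m).
  move=> c; have [le1 _ _ _] := HY m; have := le1 (enum_val c).
  by rewrite /coordinate enum_valK ler_norml /= in_itv.
have FK : (Y_ @ \oo) K by exists 0%N => // m _; exact: YK.
have [Y [_ clY]] := Kc (Y_ @ \oo) _ FK.
have approx (U : set conf) e N : nbhs Y U -> 0 < e -> exists m, [/\ (N <= m)%N, U (Y_ m) &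
    forall x, `|coordinate (Y_ m) x - coordinate Y x| < e].
  move=> UY e0; have FN : (Y_ @ \oo) [set Y_ m | m in [set m | (N <= m)%N]].
    by exists N => // m /= Nm; exists m.
  have [_ [[m Nm <-] [UYm bYm]]] := clY _ _ FN (filterI UY (nbhsx_ballx Y e e0)).
  exists m; split=> // x; have [_ /(_ ord0 (enum_rank x))] := bYm.
  by rewrite /ball /= distrC.
have near_T : nbhs Y [set: conf] by exact: filterT.
exists Y; split.
- move=> t; apply/andP; split; rewrite leNgt; apply/negP => lt.
    have e0 : 0 < - coordinate Y (t, 0) by lra.
    have [m [_ _ /(_ (t, 0))]] := approx _ _ 0%N near_T e0.
    by have [_ /(_ t)/andP[]] := HY m; rewrite ltr_norml => ? ? _ _ /andP[]; lra.
  have e0 : 0 < coordinate Y (t, 0) - 2^-1 by lra.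
  have [m [_ _ /(_ (t, 0))]] := approx _ _ 0%N near_T e0.
  by have [_ /(_ t)/andP[]] := HY m; rewrite ltr_norml => ? ? _ _ /andP[]; lra.
- have e0 : 0 < 16^-1 :> R by rewrite invr_gt0 ltr0n.
  have [m [_ _ close]] := approx _ _ 0%N near_T e0.
  have [_ _ [t [i ti]] _] := HY m; exists t, i; apply/eqP => E.
  have := close (t, i); have := close (t, 0); rewrite E !ltr_norml => /andP[A1 A2] /andP[B1 B2].
  by move: ti; rewrite leNgt => /negP; apply; rewrite ltr_norml; apply/andP; split; lra.
move=> a.
suff le i b : edge (idx a) b Y <= edge (idx a) i Y by move=> i b; apply/eqP; rewrite eq_le !le.
rewrite leNgt; apply/negP => lt.
pose g := (edge (idx a) b Y - edge (idx a) i Y) / 2.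
have g0 : 0 < g by rewrite /g; lra.
have nb := edge_near b Y (idx_range a) g0; have ni := edge_near i Y (idx_range a) g0.
pose U := [set W | `|edge (idx a) b W - edge (idx a) b Y| < g] `&`
          [set W | `|edge (idx a) i W - edge (idx a) i Y| < g].
have /nbhs_ballP[r /= r0 rball] : nbhs Y U by exact: filterI nb ni.
have r2 : 0 < r / 2 by lra.
have [m [Nm _ close]] := approx _ _ (Num.bound (2 / r)) near_T r2.
have [_ _ _ /(_ a i)[Z ZY /(_ b)]] := HY m.
have small : ((4 * m.+3)%:R)^-1 <= r / 2.
  have : 2 / r < (Num.bound (2 / r))%:R by apply: archi_boundP; rewrite divr_ge0 // ltW.
  have : (Num.bound (2 / r))%:R <= (4 * m.+3)%:R :> R by rewrite ler_nat; lia.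
  move=> A B; rewrite -(invrK (r / 2)) lef_pV2 ?posrE ?ltr0n ?invr_gt0 //.
  by rewrite invf_div (le_trans (ltW B)).
have [] : U Z.
  apply: rball; split=> // c x; rewrite (ord1 c) /ball /=.
  have := ZY (enum_val x); have := close (enum_val x); rewrite /coordinate enum_valK.
  by move=> yw zy; exact: (near_trans yw zy small).
by rewrite /= !ltr_norml /g => /andP[A1 A2] /andP[B1 B2] le_Z; lra.
Qed.

End Configurations.

Theorem theorem1p3 (R : realType) (d p : nat)
  (d_ge1 : (1 <= d)%N) (p_prime : prime p) (p_odd : odd p)
  (p_le : (p <= 2 * d + 1)%N)
  (p_form : forall j : nat, (1 <= j <= p.-1)%N ->
     (p.-1 ^ 2 %/ 2)%N <> (j * d + 1)%N) :
  admissible R d p.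
Proof.
case: d d_ge1 p_le {p_form} => // D' _ p_le f rho f_cont f_inj rho_metric.
have p2 : (2 < p)%N by exact: odd_prime_gt2.
pose m := (p.-1 %/ 2)%N.
have m0 : (0 < m)%N by rewrite divn_gt0 //; lia.
have mD : (m <= D'.+1)%N by rewrite /m; lia.
(* When m < d, the remaining labellings repeat the first metric. *)
pose idx (a : 'I_D'.+1) : nat := if (a < m)%N then a.+1 else 1%N.
have idx_range a : (1 <= idx a <= p.-1 %/ 2)%N.
  by rewrite /idx -/m; case: ifP => [am|_]; rewrite ?m0 //.
have [Y [Y0 [t [i ti]] Yedge]] :=
  limit_configuration p_prime p_odd f_cont rho_metric idx_range.
have edgeE j a b : (1 <= j <= m)%N -> edge f rho j a Y = edge f rho j b Y.
  move=> /andP[j0 jm]; have jD : (j.-1 < D'.+1)%N by lia.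
  have idxE : idx (Ordinal jD) = j.
    by rewrite /idx /= (prednK j0) ifT //; lia.
  by have := Yedge (Ordinal jD) b a; rewrite idxE.
have x_sphere a : sphere R D'.+1 (chart (point Y a)) by exact: chart_sphere.
have edge0 j a : (1 <= j <= m)%N ->
    edge f rho j a Y = 0 <-> f (chart (point Y a)) = f (chart (point Y (a + j%:R))).
  by move=> /rho_metric[[_ eq0 _ _] _]; exact: eq0.
(* A coincidence of f x_a and f x_(a+j) makes all the points equal, contrary
   to [chart_inj]: the points i and 0 of Y differ and the point 0 is in the small cube. *)
have collapse j a : (1 <= j <= m)%N ->
    f (chart (point Y a)) = f (chart (point Y (a + j%:R))) -> False.
  move=> jm /(edge0 _ _ jm) ej.
  have same b : chart (point Y (b + j%:R)) = chart (point Y b).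
    by apply: f_inj => //; apply/esym/(edge0 _ _ jm); rewrite (edgeE _ _ a).
  have same_iter l : chart (point Y (l%:R * j%:R)) = chart (point Y 0).
    by elim: l => [|l IH]; rewrite ?mul0r // -natr1 mulrDl mul1r same.
  have j_unit : (j%:R : 'Z_p) \is a GRing.unit.
    rewrite unitZpE ?prime_gt1 // prime_coprime // gtnNdvd //; first by case/andP: jm.
    by move: jm; rewrite /m; lia.
  have := same_iter (i / j%:R : 'Z_p); rewrite natr_Zp divrK // => /esym/chart_inj E.
  move/eqP: ti; apply; have /rowP/(_ t) : point Y 0 = point Y i.
    apply: E; apply: norm_le_entries; first by rewrite invr_ge0.
    by move=> s; rewrite mxE ger0_norm; have /andP[] := Y0 s.
  by rewrite !mxE.
exists (fun a => chart (point Y a)); split=> // [a b ab|j jm a]; last first.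
  have := edgeE j (a * j%:R) 0 jm; rewrite /edge /image_point add0r => <-.
  by rewrite mulrDl mul1r.
apply/eqP; apply: contraT => neq; exfalso.
(* Either b - a or a - b is the residue of a number between 1 and m. *)
have c0 : b - a != 0 by rewrite subr_eq0 eq_sym.
have c_val : (0 < ((b - a)%R : 'Z_p))%N by rewrite lt0n; apply: contra c0 => /eqP c; apply/eqP/val_inj.
have c_lt : (((b - a)%R : 'Z_p) < p)%N by apply: leq_trans (ltn_ord _) _; rewrite Zp_cast ?prime_gt1.
have [le|gt] := leqP ((b - a)%R : 'Z_p) m.
  apply: (collapse ((b - a)%R : 'Z_p) a); first by rewrite c_val.
  by rewrite natr_Zp addrC subrK.
apply: (collapse (p - ((b - a)%R : 'Z_p))%N b).
  by move: c_val c_lt gt p_odd; rewrite /m; move: (nat_of_ord (b - a)%R) => c; lia.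
by rewrite natrB ?(ltnW c_lt) // pchar_Zp ?prime_gt1 // sub0r natr_Zp opprB addrC subrK.
Qed.
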